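(* Let $G$ be a finite group admitting a diagonal double Kodaira structure (of some type $(b,n)$ with $b,n\ge 2$). Then $|G|\ge 32$. Moreover, a group of order $32$ admits a diagonal double Kodaira structure if and only if it is extra-special. Furthermore: (1) Each of the two extra-special groups $G$ of order $32$ (up to isomorphism) admits exactly $2211840=1152\cdot 1920$ diagonal double Kodaira structures of type $(b,n)=(2,2)$. Every such structure $\mathfrak S$ is strong and satisfies $\sigma(\mathfrak S)=16$. (2) If $G=\mathsf{H}_5(\mathbb Z_2)$ (the group $G(32,49)$), these structures form $1920$ orbits under the action of $\operatorname{Aut}(G)$. (3) If $G=\mathsf{G}_5(\mathbb Z_2)$ (the group $G(32,50)$), these structures form $1152$ orbits under the action of $\operatorname{Aut}(G)$.
   Context: Conventions: $[x,y]=xyx^{-1}y^{-1}$, $o(x)$ is the order of $x$, $\mathbb Z_m$ is the cyclic group of order $m$, $Z(G)$ is the center of $G$, and $G(m,t)$ is the group of label $(m,t)$ in the GAP small groups library. Diagonal double Kodaira structures. Let $G$ be a finite group and $b,n\ge 2$ integers. A diagonal double Kodaira structure of type $(b,n)$ on $G$ is an ordered tuple (repetitions allowed) $$\mathfrak S=(r_{11},t_{11},\ldots,r_{1b},t_{1b},\,r_{21},t_{21},\ldots,r_{2b},t_{2b},\,z)$$ of $4b+1$ elements generating $G$, with $o(z)=n$, satisfying the following relations (for all $j,k\in\{1,\dots,b\}$). Surface relations: $$[r_{1b}^{-1},t_{1b}^{-1}]\,t_{1b}^{-1}\,[r_{1,b-1}^{-1},t_{1,b-1}^{-1}]\,t_{1,b-1}^{-1}\cdots[r_{11}^{-1},t_{11}^{-1}]\,t_{11}^{-1}\,(t_{11}t_{12}\cdots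 t_{1b})=z,$$ $$[r_{21}^{-1},t_{21}]\,t_{21}\,[r_{22}^{-1},t_{22}]\,t_{22}\cdots[r_{2b}^{-1},t_{2b}]\,t_{2b}\,(t_{2b}^{-1}t_{2,b-1}^{-1}\cdots t_{21}^{-1})=z^{-1}.$$ Conjugacy action of $r_{1j}$: $[r_{1j},r_{2k}]=1$ if $j<k$; $[r_{1j},r_{2j}]=1$; $[r_{1j},r_{2k}]=z^{-1}r_{2k}r_{2j}^{-1}\,z\,r_{2j}r_{2k}^{-1}$ if $j>k$; $[r_{1j},t_{2k}]=1$ if $j<k$; $[r_{1j},t_{2j}]=z^{-1}$; $[r_{1j},t_{2k}]=[z^{-1},t_{2k}]$ if $j>k$; $[r_{1j},z]=[r_{2j}^{-1},z]$. Conjugacy action of $t_{1j}$: $[t_{1j},r_{2k}]=1$ if $j<k$; $[t_{1j},r_{2j}]=t_{2j}^{-1}zt_{2j}$; $[t_{1j},r_{2k}]=[t_{2j}^{-1},z]$ if $j>k$; $[t_{1j},t_{2k}]=1$ if $j<k$; $[t_{1j},t_{2j}]=[t_{2j}^{-1},z]$; $[t_{1j},t_{2k}]=t_{2j}^{-1}zt_{2j}z^{-1}t_{2k}\,z\,t_{2j}^{-1}z^{-1}t_{2j}t_{2k}^{-1}$ if $j>k$; $[t_{1j},z]=[t_{2j}^{-1},z]$. Put $K_1=\langle r_{11},t_{11},\ldots,r_{1b},t_{1b},z\rangle$ and $K_2=\langle r_{21},t_{21},\ldots,r_{2b},t_{2b},z\rangle$. The structure is called strong if $K_1=K_2=G$.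 Its signature is $$\sigma(\mathfrak S)=\tfrac13\,|G|\,(2b-2)\left(1-\tfrac1{n^2}\right).$$ The group $\operatorname{Aut}(G)$ acts on structures entrywise. Extra-special groups. A finite $p$-group $G$ is extra-special if $Z(G)$ is cyclic of order $p$ and $G/Z(G)$ is a non-trivial elementary abelian $p$-group. Up to isomorphism there are exactly two extra-special groups of order $32$: $\mathsf{H}_5(\mathbb Z_2)=\langle r_1,t_1,r_2,t_2,z\mid r_j^2=t_j^2=z^2=1,\ [r_j,z]=[t_j,z]=1,\ [r_j,r_k]=[t_j,t_k]=1,\ [r_j,t_k]=z^{-\delta_{jk}}\rangle$, and $\mathsf{G}_5(\mathbb Z_2)=\langle r_1,t_1,r_2,t_2,z\mid r_1^2=t_1^2=z^2=1,\ r_2^2=t_2^2=z,\ [r_j,z]=[t_j,z]=1,\ [r_j,r_k]=[t_j,t_k]=1,\ [r_j,t_k]=z^{-\delta_{jk}}\rangle$ (indices in $\{1,2\}$, $\delta_{jk}$ the Kronecker symbol). *)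

(* Defs.v *)
From mathcomp Require Import all_boot all_order all_algebra.
From mathcomp Require Import all_fingroup all_solvable.

Set Implicit Arguments.
Unset Strict Implicit.
Unset Printing Implicit Defensive.

Local Open Scope group_scope.

(* [x, y] = x y x^-1 y^-1; the library's [~ x, y] is x^-1 y^-1 x y. *)
Definition cmt (gT : finGroupType) (x y : gT) : gT := x * y * x^-1 * y^-1.

(* A tuple (r_{1j}, t_{1j}, r_{2j}, t_{2j}, z) of 4b+1 elements, stored as four
   families and one element; the index j ranges over 0, ..., b-1 instead of
   1, ..., b. *)
Definition ddkTuple (gT : finGroupType) (b : nat) : finType :=
  ({ffun 'I_b -> gT} * {ffun 'I_b -> gT} *
   {ffun 'I_b -> gT} * {ffun 'I_b -> gT} * gT)%type.

Definition ddk_r1 gT b (S : ddkTuple gT b) : {ffun 'I_b -> gT} := S.1.1.1.1.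
Definition ddk_t1 gT b (S : ddkTuple gT b) : {ffun 'I_b -> gT} := S.1.1.1.2.
Definition ddk_r2 gT b (S : ddkTuple gT b) : {ffun 'I_b -> gT} := S.1.1.2.
Definition ddk_t2 gT b (S : ddkTuple gT b) : {ffun 'I_b -> gT} := S.1.2.
Definition ddk_z gT b (S : ddkTuple gT b) : gT := S.2.

Definition ddk_K1 gT b (S : ddkTuple gT b) : {group gT} :=
  <<ddk_z S |: ([set ddk_r1 S j | j : 'I_b] :|: [set ddk_t1 S j | j : 'I_b])>>%G.
Definition ddk_K2 gT b (S : ddkTuple gT b) : {group gT} :=
  <<ddk_z S |: ([set ddk_r2 S j | j : 'I_b] :|: [set ddk_t2 S j | j : 'I_b])>>%G.

Definition ddk_generated gT b (S : ddkTuple gT b) : {group gT} :=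
  <<ddk_z S |: ([set ddk_r1 S j | j : 'I_b] :|: [set ddk_t1 S j | j : 'I_b]
            :|: [set ddk_r2 S j | j : 'I_b] :|: [set ddk_t2 S j | j : 'I_b])>>%G.

(* The products over rev_ord i run through the indices in decreasing order. *)
Definition surface_relations gT b (S : ddkTuple gT b) : bool :=
  let r1 := ddk_r1 S in let t1 := ddk_t1 S in
  let r2 := ddk_r2 S in let t2 := ddk_t2 S in let z := ddk_z S in
  [&& (\prod_(i < b) (cmt (r1 (rev_ord i))^-1 (t1 (rev_ord i))^-1
                      * (t1 (rev_ord i))^-1))
      * \prod_(i < b) t1 i == z
    & (\prod_(i < b) (cmt (r2 i)^-1 (t2 i) * t2 i))
      * \prod_(i < b) (t2 (rev_ord i))^-1 == z^-1].

Definition r1_action_relations gT b (S : ddkTuple gT b) : bool :=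
  let r1 := ddk_r1 S in
  let r2 := ddk_r2 S in let t2 := ddk_t2 S in let z := ddk_z S in
  [forall j : 'I_b, forall k : 'I_b,
    [&& (j < k)%N ==> (cmt (r1 j) (r2 k) == 1),
        cmt (r1 j) (r2 j) == 1,
        (k < j)%N ==>
          (cmt (r1 j) (r2 k)
             == z^-1 * r2 k * (r2 j)^-1 * z * r2 j * (r2 k)^-1),
        (j < k)%N ==> (cmt (r1 j) (t2 k) == 1),
        cmt (r1 j) (t2 j) == z^-1,
        (k < j)%N ==> (cmt (r1 j) (t2 k) == cmt z^-1 (t2 k))
      & cmt (r1 j) z == cmt (r2 j)^-1 z]].

Definition t1_action_relations gT b (S : ddkTuple gT b) : bool :=
  let t1 := ddk_t1 S in
  let r2 := ddk_r2 S in let t2 := ddk_t2 S in let z := ddk_z S in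
  [forall j : 'I_b, forall k : 'I_b,
    [&& (j < k)%N ==> (cmt (t1 j) (r2 k) == 1),
        cmt (t1 j) (r2 j) == (t2 j)^-1 * z * t2 j,
        (k < j)%N ==> (cmt (t1 j) (r2 k) == cmt (t2 j)^-1 z),
        (j < k)%N ==> (cmt (t1 j) (t2 k) == 1),
        cmt (t1 j) (t2 j) == cmt (t2 j)^-1 z,
        (k < j)%N ==>
          (cmt (t1 j) (t2 k)
             == (t2 j)^-1 * z * t2 j * z^-1 * t2 k
                * z * (t2 j)^-1 * z^-1 * t2 j * (t2 k)^-1)
      & cmt (t1 j) z == cmt (t2 j)^-1 z]].

Definition is_ddk gT (G : {group gT}) (b n : nat) (S : ddkTuple gT b) : bool :=
  [&& (2 <= b)%N, (2 <= n)%N, ddk_generated S == G, #[ddk_z S] == n,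
      surface_relations S, r1_action_relations S & t1_action_relations S].

Definition ddk_structures gT (G : {group gT}) (b n : nat) :
    {set ddkTuple gT b} :=
  [set S | is_ddk G n S].

Definition admits_ddk gT (G : {group gT}) : Prop :=
  exists b n : nat, exists S : ddkTuple gT b, is_ddk G n S.

Definition ddk_strong gT (G : {group gT}) b (S : ddkTuple gT b) : Prop :=
  ddk_K1 S = G /\ ddk_K2 S = G.

Definition ddk_signature gT (G : {group gT}) b (S : ddkTuple gT b) : rat :=
  (3%:R^-1 * #|G|%:R * (2%:R * b%:R - 2%:R)
     * (1 - (#[ddk_z S]%:R ^+ 2)^-1))%R.

Definition ddk_act gT b (S : ddkTuple gT b) (a : {perm gT}) : ddkTuple gT b :=
  ([ffun j => a (ddk_r1 S j)], [ffun j => a (ddk_t1 S j)],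
   [ffun j => a (ddk_r2 S j)], [ffun j => a (ddk_t2 S j)], a (ddk_z S)).

Lemma ddk_act1 gT b : @ddk_act gT b ^~ 1 =1 id.
Proof.
case=> [[[[r1 t1] r2] t2] z]; rewrite /ddk_act perm1; congr (_, _, _, _, _).
all: by apply/ffunP=> j; rewrite ffunE perm1.
Qed.

Lemma ddk_actM gT b : forall S, act_morph (@ddk_act gT b) S.
Proof.
move=> S a a'; rewrite /ddk_act permM; congr (_, _, _, _, _).
all: by apply/ffunP=> j; rewrite !ffunE permM.
Qed.

Canonical ddk_action gT b := TotalAction (@ddk_act1 gT b) (@ddk_actM gT b).

(* Aut G consists of the permutations of gT that are trivial outside G and
   restrict to automorphisms of G. *)
Definition ddk_orbits gT (G : {group gT}) (b n : nat) :
    {set {set ddkTuple gT b}} :=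
  orbit (ddk_action gT b) (Aut G) @: ddk_structures G b n.

(* Both presented groups are finite (of order at most 32), so that \isog Grp is
   isomorphism with the presented group. The relations [r_j, r_j] = 1 and
   [t_j, t_j] = 1 are trivial and omitted. *)
Definition is_H5Z2 gT (G : {group gT}) : Prop :=
  G \isog Grp (r1 : t1 : r2 : t2 : z :
    r1 ^+ 2, t1 ^+ 2, r2 ^+ 2, t2 ^+ 2, z ^+ 2,
    r1 * z * r1^-1 * z^-1, t1 * z * t1^-1 * z^-1,
    r2 * z * r2^-1 * z^-1, t2 * z * t2^-1 * z^-1,
    r1 * r2 * r1^-1 * r2^-1, t1 * t2 * t1^-1 * t2^-1,
    r1 * t1 * r1^-1 * t1^-1 = z^-1, r2 * t2 * r2^-1 * t2^-1 = z^-1,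
    r1 * t2 * r1^-1 * t2^-1, r2 * t1 * r2^-1 * t1^-1).

Definition is_G5Z2 gT (G : {group gT}) : Prop :=
  G \isog Grp (r1 : t1 : r2 : t2 : z :
    r1 ^+ 2, t1 ^+ 2, z ^+ 2, r2 ^+ 2 = z, t2 ^+ 2 = z,
    r1 * z * r1^-1 * z^-1, t1 * z * t1^-1 * z^-1,
    r2 * z * r2^-1 * z^-1, t2 * z * t2^-1 * z^-1,
    r1 * r2 * r1^-1 * r2^-1, t1 * t2 * t1^-1 * t2^-1,
    r1 * t1 * r1^-1 * t1^-1 = z^-1, r2 * t2 * r2^-1 * t2^-1 = z^-1,
    r1 * t2 * r1^-1 * t2^-1, r2 * t1 * r2^-1 * t1^-1).

(* The library's extraspecial asks for 'Phi(G) = 'Z(G) = G^`(1), of prime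
   order; for a p-group this is the definition by Z(G) and G / Z(G). *)
Lemma extraspecialP gT (p : nat) (G : {group gT}) : prime p -> p.-group G ->
  extraspecial G <->
  [/\ cyclic 'Z(G), #|'Z(G)| = p, p.-abelem (G / 'Z(G)) & G / 'Z(G) != 1].
Proof.
move=> p_pr pG; split.
- move=> esG; have oZ := card_center_extraspecial pG esG.
  have [[defPhi _] _] := esG; split=> //.
  + by rewrite prime_cyclic // oZ.
  + by rewrite -defPhi (Phi_quotient_abelem pG).
  apply: contra (extraspecial_nonabelian esG); rewrite -subG1.
  by rewrite quotient_sub1 ?gFnorm // subsetI subxx.
case=> _ oZ abGZ ntGZ.
have nZG : G \subset 'N('Z(G)) by rewrite gFnorm.
have sPhiZ : 'Phi(G) \subset 'Z(G) by apply: Phi_min pG nZG abGZ.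
have sG'Phi : G^`(1) \subset 'Phi(G) by rewrite (Phi_joing pG) joing_subl.
have ntG' : G^`(1) != 1.
  apply: contra ntGZ => /eqP/derG1P abG.
  by rewrite (center_idP abG) trivg_quotient.
have prZ : prime #|'Z(G)| by rewrite oZ.
have sZG' : 'Z(G) \subset G^`(1).
  apply: prime_meetG => //.
  by rewrite (setIidPr (subset_trans sG'Phi sPhiZ)).
split=> //; split; apply/eqP; rewrite eqEsubset.
  by rewrite sPhiZ (subset_trans sZG').
by rewrite sZG' (subset_trans sG'Phi).
Qed.

(* Main.v *)
Require Import Defs.
From mathcomp Require Import all_boot all_order all_algebra.
From mathcomp Require Import all_fingroup all_solvable.
From mathcomp Require Import zify.

Set Implicit Arguments.
Unset Strict Implicit.
Unset Printing Implicit Defensive.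

Local Open Scope group_scope.

(** The order bound only uses the relations of one pair of indices j < k. Write
    a, b, c, d for the components r1, t1, r2, t2 at j and a', b', c', d' for
    those at k. The nontrivial commutators [b', c'], [a', d'], [b, c], [a, d],
    together with the trivial ones above that diagonal, say that each step of
    the chain G > C(c') > C(c', d') > C(c', d', c) > C(c', d', c, d) is strict
    (linked_index). Hence |G| is at least 16 times the order of the last
    centralizer, and |G| >= 32 as soon as that centralizer is nontrivial.
    Otherwise G has trivial center and, if |G| < 32, four factors >= 2 leave
    only |G| = 16, excluded because 2-groups have a center, and |G| = 24. The
    latter case looks like the symmetric group of degree 4: C(a) and C(c') are
    two different nonabelian subgroups of order 8 that meet in a normal Klein
    four-group containing z, and the relations between z and the other
    components are contradictory there (prestructure_card).

    For |G| = 32 the element z is central: otherwise the relations survive in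
    G / Z(G) with the image of z nontrivial, although G / Z(G) has order less
    than 32 (prestructure_central). Then the chain above has all its indices
    equal to 2, so Z(G) = {1, z}; applied inside K1 and K2 it gives
    K1 = K2 = G, and since K1 and K2 commute modulo z, the group G is
    extraspecial.

    Conversely, an extraspecial G of order 32 has a frame e1, f1, e2, f2: a
    lift of a symplectic basis of G / Z(G) over the field of 2 elements. Normal
    forms in a frame turn commutation in G into the alternating form on the
    vectors of 4 bits (word_comm) and squaring into the diagonal of a cocycle.
    As z is central, a structure of type (2, 2) amounts to two bases of
    G / Z(G), formed by the r1, t1 and by the r2, t2, that are dual for the
    alternating form up to the exchange of r and t, with one condition on each
    from the surface relations. There are 8640 such pairs, each with 2 ^ 8
    lifts to G.

    An automorphism of G is determined by the image of a frame, which can be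
    any frame with the same squares. Counting these frames gives
    #|Aut G| = 16 * 72 or 16 * 120 for the two presented groups. Since the
    components of a structure generate G, automorphisms act freely on
    structures, so the number of orbits is 2211840 divided by #|Aut G|. *)

(** * Chains of centralizers *)

Lemma cent1_step (gT : finGroupType) (H : {group gT}) x y :
  y \in H -> y \notin 'C[x] ->
  exists2 m, (2 <= m)%N & #|H| = (m * #|'C_H[x]|)%N.
Proof.
move=> Hy nCy; exists #|H : 'C_H[x]|; last by rewrite mulnC Lagrange ?subsetIl.
by rewrite indexg_gt1; apply: contra nCy => /subsetP/(_ y Hy)/setIP[].
Qed.

(** The ten commutation conditions between the components at two indices j < k
    that the chain of centralizers needs. *)
Record linked {gT : finGroupType} (a b c d a' b' c' d' : gT) : Prop := Linked {
  link_ac : a \in 'C[c];   link_ac' : a \in 'C[c']; link_ad' : a \in 'C[d'];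
  link_bc' : b \in 'C[c']; link_bd' : b \in 'C[d']; link_a'c' : a' \in 'C[c'];
  unlink_ad : a \notin 'C[d];    unlink_bc : b \notin 'C[c];
  unlink_a'd' : a' \notin 'C[d']; unlink_b'c' : b' \notin 'C[c'] }.

(** The exchange of r1, t1 with r2, t2, combined with that of the two indices,
    preserves the pattern. *)
Lemma linked_dual (gT : finGroupType) (a b c d a' b' c' d' : gT) :
  linked a b c d a' b' c' d' -> linked c' d' a' b' c d a b.
Proof. by case=> *; split; rewrite 1?cent1C. Qed.

Section Linked.

Variables (gT : finGroupType) (K : {group gT}) (a b c d a' b' c' d' : gT).
Hypothesis abcd : linked a b c d a' b' c' d'.
Hypotheses (Ka : a \in K) (Kb : b \in K) (Ka' : a' \in K) (Kb' : b' \in K).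

(** The strict steps of the chain are witnessed by b', a', b and a in this
    order. *)
Lemma linked_index : exists m1 m2 m3 m4, [/\ [/\ (2 <= m1)%N, (2 <= m2)%N,
      (2 <= m3)%N & (2 <= m4)%N],
    #|K| = (m1 * #|'C_K[c']|)%N,
    #|'C_K[c']| = (m2 * (m3 * #|'C_K[c'] :&: 'C[d'] :&: 'C[c]|))%N &
    #|'C_K[c'] :&: 'C[d'] :&: 'C[c]|
      = (m4 * #|'C_K[c'] :&: 'C[d'] :&: 'C[c] :&: 'C[d]|)%N].
Proof.
case: abcd => ac ac' ad' bc' bd' a'c' n4 n3 n2 n1.
have [m1 g1 e1] := cent1_step Kb' n1.
have [|m2 g2 e2] := @cent1_step _ 'C_K[c']%G d' a' _ n2.
  by rewrite inE Ka'.
have [|m3 g3 e3] := @cent1_step _ ('C_K[c'] :&: 'C[d'])%G c b _ n3.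
  by rewrite !in_setI Kb bc'.
have [|m4 g4 e4] :=
    @cent1_step _ ('C_K[c'] :&: 'C[d'] :&: 'C[c])%G d a _ n4.
  by rewrite !in_setI Ka ac' ad'.
by exists m1, m2, m3, m4; split; rewrite // -?e3.
Qed.

Lemma linked_card :
  (16 * #|'C_K[c'] :&: 'C[d'] :&: 'C[c] :&: 'C[d]| <= #|K|)%N.
Proof.
have [m1 [m2 [m3 [m4 [[g1 g2 g3 g4] -> -> ->]]]]] := linked_index.
rewrite !mulnA leq_mul2r; apply/orP; right.
exact: leq_mul (leq_mul (leq_mul g1 g2) g3) g4.
Qed.

Lemma linked_card_ge32 w : w \in K -> w != 1 ->
    [/\ w \in 'C[c], w \in 'C[d], w \in 'C[c'] & w \in 'C[d']] ->
  (32 <= #|K|)%N.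
Proof.
move=> Kw nt_w [wc wd wc' wd']; apply: leq_trans linked_card.
rewrite (@leq_pmul2l 16 2) // cardG_gt1; apply/trivgPn; exists w => //.
by rewrite !in_setI Kw wc wd wc' wd'.
Qed.

Lemma linked_center w : c \in K -> d \in K -> c' \in K -> d' \in K ->
  #|K| = 32%N -> w \in 'Z(K) -> w != 1 -> 'Z(K) = [set 1; w].
Proof.
move=> Kc Kd Kc' Kd' oK Zw nt_w; apply/esym/eqP.
rewrite eqEcard subUset !sub1set group1 Zw /= cards2 eq_sym nt_w.
have := linked_card; rewrite oK (@leq_pmul2l 16 _ 2) //.
apply: leq_trans; apply: subset_leq_card; apply/subsetP=> y /setIP[Ky].
rewrite -sub_cent1 => /subsetP cy.
by rewrite !in_setI Ky /= !(cent1C y) !cy.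
Qed.

End Linked.

(** * Groups of order less than 32 *)

Lemma card12_large_center_abelian (gT : finGroupType) (M : {group gT}) :
  #|M| = 12%N -> (3 <= #|'Z(M)|)%N -> abelian M.
Proof.
move=> oM geZ.
have sZM : 'Z(M) \subset M by apply: center_sub.
have [i oi] : exists i, (#|'Z(M)| * i = 12)%N.
  by exists #|M : 'Z(M)|; rewrite Lagrange.
have nZM : 'Z(M) <| M by apply: center_normal.
have oq : #|M / 'Z(M)| = i.
  apply/eqP; rewrite card_quotient ?normal_norm // -(eqn_pmul2l (cardG_gt0 'Z(M))).
  by rewrite Lagrange // oM oi.
case: (leqP i 3) => le_i.
  apply: cyclic_center_factor_abelian.
  have [i1 | ne1] := eqVneq i 1%N.
    by move/eqP: oq; rewrite i1 -trivg_card1 => /eqP->; apply: cyclic1.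
  apply: prime_cyclic; rewrite oq.
  by case: i le_i oi ne1 {oq} => [|[|[|[]]]] //; rewrite muln0.
have oZ : #|'Z(M)| = 3%N.
  by nia.
have [P sylP] := Sylow_exists 2 M.
have oP : #|P| = 4%N by rewrite (card_Hall sylP) oM p_part.
have tiZP : 'Z(M) :&: P = 1.
  by apply: coprime_TIg; rewrite oZ oP.
have sPM : P \subset M by apply: pHall_sub sylP.
have <- : 'Z(M) * P = M.
  apply/eqP; rewrite eqEcard mul_subG //=.
  by rewrite TI_cardMg // oZ oP oM.
rewrite abelianM center_abelian (@card_p2group_abelian _ 2) //=.
by rewrite centsC (subset_trans (subsetIr M _)) ?centS.
Qed.

Lemma four_factors m1 m2 m3 m4 :
    [/\ 2 <= m1, 2 <= m2, 2 <= m3 & 2 <= m4]%N ->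
    (m1 * (m2 * (m3 * m4)) < 32)%N -> (m1 * (m2 * (m3 * m4)))%N <> 16%N ->
  [/\ (m1 * (m2 * (m3 * m4)) = 24)%N,
      (m2 * (m3 * m4) = 8)%N \/ (m2 * (m3 * m4) = 12)%N
    & (m2 * (m3 * m4) = 8)%N -> m4 = 2%N].
Proof.
case=> g1 g2 g3 g4 lt n16.
have bound x y : (8 <= y -> x * y < 32 -> x < 4)%N by nia.
have h34 : (4 <= m3 * m4)%N := leq_mul g3 g4.
have h12 : (4 <= m1 * m2)%N := leq_mul g1 g2.
have l1 : (m1 < 4)%N by apply: bound lt; apply: (leq_mul g2 h34).
have l2 : (m2 < 4)%N.
  by apply: (bound _ (m1 * (m3 * m4))%N (leq_mul g1 h34)); rewrite mulnCA.
have l3 : (m3 < 4)%N.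
  apply: (bound _ (m1 * m2 * m4)%N (leq_mul h12 g4)).
  by rewrite mulnCA -mulnA.
have l4 : (m4 < 4)%N.
  by apply: (bound _ (m1 * m2 * m3)%N (leq_mul h12 g3)); rewrite mulnC -!mulnA.
have two_three m : (2 <= m -> m < 4 -> m = 2 \/ m = 3)%N by lia.
case: (two_three _ g1 l1) lt n16 => ->; case: (two_three _ g2 l2) => ->;
  case: (two_three _ g3 l3) => ->; case: (two_three _ g4 l4) => -> // _ n16;
  by [case: n16 | split=> //; (left + right)].
Qed.

(** The chain of centralizers ends with the trivial group, since G has order
    less than 32; so |G| = 24 and exactly one of the four indices is 3. If it is
    not the first one, C(c') is normal of order 12 and its center contains the
    conjugates c' and c' ^ b' of c', which makes C(c') abelian; then b
    centralizes both C(c') and d', hence G, and is trivial. *)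
Lemma small_linked (gT : finGroupType) (G : {group gT})
    (a b c d a' b' c' d' : gT) :
    linked a b c d a' b' c' d' ->
    [/\ a \in G, b \in G, a' \in G & b' \in G] ->
    [/\ c \in G, d \in G, c' \in G & d' \in G] ->
    (#|G| < 32)%N ->
  [/\ #|G| = 24%N, #|'C_G[c']| = 8%N & a ^+ 2 = 1].
Proof.
move=> L [Ga Gb Ga' Gb'] [Gc Gd Gc' Gd'] ltG.
have ncen w : w \in G -> G \subset 'C[w] -> w = 1.
  move=> Gw /subsetP sGC; apply/eqP; apply: contraLR ltG => nt_w; rewrite -leqNgt.
  by apply: (linked_card_ge32 L Ga Gb Ga' Gb' Gw) => //;
    split; rewrite cent1C sGC.
have [m1 [m2 [m3 [m4 [[g1 g2 g3 g4] e1 e2 e3]]]]] :=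
  linked_index L Ga Gb Ga' Gb'.
have e4 : #|'C_G[c'] :&: 'C[d'] :&: 'C[c] :&: 'C[d]| = 1%N.
  have [//|] := eqVneq #|'C_G[c'] :&: 'C[d'] :&: 'C[c] :&: 'C[d]| 1%N.
  rewrite -trivg_card1 => /trivgPn[w]; rewrite !in_setI -!andbA.
  case/and5P=> Gw wc' wd' wc wd nt_w.
  have := linked_card_ge32 L Ga Gb Ga' Gb' Gw nt_w.
  by rewrite leqNgt ltG => /(_ (And4 wc wd wc' wd')).
rewrite {}e4 muln1 in e3.
have nt_b : b != 1.
  by apply: contraNneq (unlink_bc L) => ->; rewrite group1.
have n16 : #|G| <> 16%N.
  move=> o16; have pG : 2.-group G by rewrite /pgroup o16.
  have Z1 : 'Z(G) = 1.
    apply/trivgP/subsetP=> w /setIP[Gw cw]; rewrite inE (ncen w) //.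
    by rewrite sub_cent1.
  by have := trivg_center_pgroup pG Z1; move/(congr1 (fun A : {set gT} => #|A|)); rewrite o16 cards1.
have [] := @four_factors m1 m2 m3 m4 (And4 g1 g2 g3 g4); rewrite -?e3 -?e2 -?e1 //.
move=> oG [o8 /(_ o8) m4_2 | o12 _]; last first.
  pose M := 'C_G[c']%G.
  have sMG : M \subset G by apply: subsetIl.
  have iM : #|G : M| = 2%N.
    by apply/eqP; rewrite -(eqn_pmul2l (cardG_gt0 M)) Lagrange // oG /= o12.
  have nMG : M <| G by apply: index2_normal.
  have abM : abelian M.
    apply: card12_large_center_abelian => //.
    have nZ : G \subset 'N('Z(M)).
      exact: char_norm_trans (center_char M) (normal_norm nMG).
    have Zc' : c' \in 'Z(M).
      by rewrite !in_setI Gc' cent1id -sub_cent1 subsetIr.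
    have Zc'b : c' ^ b' \in 'Z(M) by rewrite memJ_norm ?(subsetP nZ).
    have nt_c' : c' != 1.
      by apply: contraNneq (unlink_b'c' L) => ->; rewrite cent1C group1.
    have: 1 |: [set c'; c' ^ b'] \subset 'Z(M).
      by rewrite !subUset !sub1set group1 Zc'.
    move/subset_leq_card; apply: leq_trans.
    rewrite cardsU1 cards2 !inE negb_or ![1 == _]eq_sym conjg_eq1 nt_c' /=.
    rewrite (_ : c' != c' ^ b') //; apply: contra (unlink_b'c' L) => /eqP eqc.
    by apply/cent1P/commute_sym/commgP/conjg_fixP; rewrite -eqc.
  have Ma' : a' \in M by rewrite inE Ga' (link_a'c' L).
  have Mb : b \in M by rewrite inE Gb (link_bc' L).
  have nMd' : d' \notin M.
    apply: contra (unlink_a'd' L) => Md'; apply: (subsetP _ _ Ma').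
    by rewrite sub_cent1 (subsetP abM).
  case/eqP: nt_b; apply: ncen => //.
  (* 'C_G[b] contains the subgroup M of index 2, and d' in addition. *)
  have sMC : M \subset 'C_G[b].
    by rewrite subsetI sMG sub_cent1 (subsetP abM).
  have : 'C_G[b] = G; last by move=> <-; apply: subsetIr.
  have [m em] : exists m, #|'C_G[b]| = (12 * m)%N.
    by exists #|'C_G[b] : M|; rewrite -(Lagrange sMC) /= o12.
  have [k ek] : exists k, (12 * m * k = 24)%N.
    by exists #|G : 'C_G[b]|; rewrite -em Lagrange ?subsetIl.
  have nm1 : m <> 1%N.
    move=> m1'; case/negP: nMd'.
    have -> : M = 'C_G[b] :> {set gT} by apply/eqP; rewrite eqEcard sMC em m1' o12.
    by rewrite inE Gd' cent1C (link_bd' L).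
  apply/eqP; rewrite eqEcard subsetIl oG em /=.
  by case: m em ek nm1 => [|[|m]] // _ _ _; rewrite -[24%N]/(12 * 2)%N leq_mul2l.
(* The centralizer of c', d' and c has order 2 and contains a. *)
split=> //; have Ca : a \in 'C_G[c'] :&: 'C[d'] :&: 'C[c].
  by rewrite !in_setI Ga (link_ac L) (link_ac' L) (link_ad' L).
by have := expg_cardG Ca; rewrite m4_2.
Qed.

Lemma cmtP (gT : finGroupType) (x y : gT) : reflect (commute x y) (cmt x y == 1).
Proof.
apply: (iffP eqP) => [|cxy]; last by rewrite /cmt cxy mulgK mulgV.
by move/(congr1 (fun w => w * y * x)); rewrite /cmt mul1g !mulgKV.
Qed.

Lemma cmt_eq1 (gT : finGroupType) (x y : gT) : (cmt x y == 1) = (x \in 'C[y]).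
Proof. by apply/cmtP/cent1P. Qed.

(** The relations between the components at two indices j < k on which the order
    bound rests. The conjugacy relations for z are put in the form
    [r2 * r1, z] = 1 and [t2 * t1, z] = 1. *)
Record prestructure (gT : finGroupType) (z a b c d a' b' c' d' : gT) : Prop :=
    Prestructure {
  pre_ac : commute a c;   pre_ac' : commute a c'; pre_ad' : commute a d';
  pre_bc' : commute b c'; pre_bd' : commute b d'; pre_a'c' : commute a' c';
  pre_ad : cmt a d = z^-1;    pre_bc : cmt b c = d^-1 * z * d;
  pre_a'd' : cmt a' d' = z^-1; pre_b'c' : cmt b' c' = d'^-1 * z * d';
  pre_caz : commute (c * a) z;    pre_dbz : commute (d * b) z;
  pre_c'a'z : commute (c' * a') z; pre_d'b'z : commute (d' * b') z }.

Lemma prestructure_linked (gT : finGroupType) (z a b c d a' b' c' d' : gT) :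
  prestructure z a b c d a' b' c' d' -> z != 1 -> linked a b c d a' b' c' d'.
Proof.
case=> ? ? ? ? ? ? ad bc a'd' b'c' ? ? ? ? nt_z; split; try exact/cent1P.
- by rewrite -cmt_eq1 ad eq_invg1.
- by rewrite -cmt_eq1 bc -mulgA -conjgE conjg_eq1.
- by rewrite -cmt_eq1 a'd' eq_invg1.
- by rewrite -cmt_eq1 b'c' -mulgA -conjgE conjg_eq1.
Qed.

Lemma nonabelian8_center (gT : finGroupType) (T : {group gT}) x :
    #|T| = 8%N -> ~~ abelian T -> x \in 'Z(T) -> x != 1 ->
  'Z(T) = [set 1; x] /\ abelian (T / 'Z(T)).
Proof.
move=> oT nabT Zx nt_x.
have dvZ : (#|'Z(T)| * #|T / 'Z(T)|)%N = 8%N.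
  by rewrite card_quotient ?normal_norm ?center_normal // Lagrange ?center_sub.
have gt1 : (2 <= #|'Z(T)|)%N by rewrite cardG_gt1; apply/trivgPn; exists x.
have gtq : (4 <= #|T / 'Z(T)|)%N.
  rewrite leqNgt; apply: contra nabT => ltq; apply: cyclic_center_factor_abelian.
  have [q1 | nq1] := eqVneq #|T / 'Z(T)| 1%N.
    by move/eqP: q1; rewrite -trivg_card1 => /eqP->; apply: cyclic1.
  by apply: prime_cyclic; case: #|_| ltq nq1 (cardG_gt0 (T / 'Z(T))%G) => [|[|[|[]]]].
have [oZ oq] : #|'Z(T)| = 2%N /\ #|T / 'Z(T)| = 4%N.
  have fac m n : (2 <= m -> 4 <= n -> m * n = 8 -> m = 2 /\ n = 4)%N by nia.
  exact: fac.
split.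
  apply/esym/eqP; rewrite eqEcard subUset !sub1set group1 Zx /=.
  by rewrite cards2 eq_sym nt_x oZ.
by apply: (@card_p2group_abelian _ 2) => //.
Qed.

Lemma cmt_conj (gT : finGroupType) (x y : gT) : cmt x y = x * x^-1 ^ y^-1.
Proof. by rewrite /cmt conjgE invgK !mulgA. Qed.

Lemma cmt_comm (gT : finGroupType) (x y : gT) : cmt x y = [~ x^-1, y^-1].
Proof. by rewrite /cmt commgEl conjgE !invgK !mulgA. Qed.

Lemma cent1_mull (gT : finGroupType) (x y v : gT) :
  x \in 'C[y] -> (x \in 'C[y * v]) = (x \in 'C[v]).
Proof. by rewrite !(cent1C x) => xy; rewrite groupMl. Qed.

(** Let |G| < 32. By small_linked and linked_dual, G has order 24 and the
    centralizers T of c' and U of a have order 8; they are nonabelian with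
    centers {1, c'} and {1, a}. They are distinct, and V = T :&: U =
    {1, a, c', a * c'} is normal in G, which T and U generate. So V contains
    [a, d] = z^-1. As b and d' commute and centralize c' and a respectively,
    one of them centralizes V. Each of the two cases determines z, from the
    elements known to commute with it, and then contradicts one of the
    nontrivial commutators. *)
Lemma prestructure_card (gT : finGroupType) (G : {group gT})
    (z a b c d a' b' c' d' : gT) :
    prestructure z a b c d a' b' c' d' -> z != 1 ->
    [/\ a \in G, b \in G, a' \in G & b' \in G] ->
    [/\ c \in G, d \in G, c' \in G & d' \in G] ->
  (32 <= #|G|)%N.
Proof.
move=> P nt_z Gabs Gcds; rewrite leqNgt; apply/negP=> ltG.
have L := prestructure_linked P nt_z.
have [oG oT a2] := small_linked L Gabs Gcds ltG.
have [_ oU _] := small_linked (linked_dual L)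
  (And4 (let: And4 _ _ h _ := Gcds in h) (let: And4 _ _ _ h := Gcds in h)
        (let: And4 h _ _ _ := Gcds in h) (let: And4 _ h _ _ := Gcds in h))
  (And4 (let: And4 _ _ h _ := Gabs in h) (let: And4 _ _ _ h := Gabs in h)
        (let: And4 h _ _ _ := Gabs in h) (let: And4 _ h _ _ := Gabs in h)) ltG.
case: Gabs Gcds => Ga Gb Ga' Gb' [Gc Gd Gc' Gd'].
pose T := 'C_G[c']%G; pose U := 'C_G[a]%G.
have Ta : a \in T by rewrite inE Ga (link_ac' L).
have Ta' : a' \in T by rewrite inE Ga' (link_a'c' L).
have Tb : b \in T by rewrite inE Gb (link_bc' L).
have Tc' : c' \in T by rewrite inE Gc' cent1id.
have Ua : a \in U by rewrite inE Ga cent1id.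
have Uc' : c' \in U by rewrite inE Gc' cent1C (link_ac' L).
have Uc : c \in U by rewrite inE Gc cent1C (link_ac L).
have Ud' : d' \in U by rewrite inE Gd' cent1C (link_ad' L).
have nTd' : d' \in T -> ~~ abelian T.
  move=> Td'; apply: contra (unlink_a'd' L) => abT.
  exact/cent1P/(centsP abT).
have nabT : ~~ abelian T.
  apply/negP=> abT; have eqTU : T = U :> {set gT}.
    apply/eqP; rewrite eqEcard oT oU leqnn andbT subsetI subsetIl /=.
    by rewrite sub_cent1 (subsetP abT).
  by move: (nTd'); rewrite {1}eqTU Ud' abT => /(_ isT).
have nabU : ~~ abelian U.
  apply/negP=> abU; have eqTU : T = U :> {set gT}.
    apply/eqP; rewrite eq_sym eqEcard oT oU leqnn andbT subsetI subsetIl /=.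
    by rewrite sub_cent1 (subsetP abU).
  by move: (nTd'); rewrite eqTU Ud' abU => /(_ isT).
have nt_a : a != 1 by apply: contraNneq (unlink_ad L) => ->; rewrite group1.
have nt_c' : c' != 1.
  by apply: contraNneq (unlink_b'c' L) => ->; rewrite cent1C group1.
have Zc' : c' \in 'Z(T) by rewrite in_setI Tc' -sub_cent1 subsetIr.
have Za : a \in 'Z(U) by rewrite in_setI Ua -sub_cent1 subsetIr.
have [ZT abT] := nonabelian8_center oT nabT Zc' nt_c'.
have [ZU abU] := nonabelian8_center oU nabU Za nt_a.
have Cz x y : commute (x * y) z -> y \in 'C[z] -> x \in 'C[z].
  by move=> xyz yz; rewrite -(groupMr _ yz); apply/cent1P.
have nac : a != c'.
  (* If a = c', then [a', d'] = z^-1 is central in T, so z^-1 = a; but b and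
     d * b centralize z, while d does not centralize a. *)
  apply/eqP=> eac; have Td' : d' \in T by rewrite /T -eac.
  have: cmt a' d' \in 'Z(T).
    apply: (subsetP (der1_min (normal_norm (center_normal _)) abT)).
    by rewrite cmt_comm mem_commg ?groupV.
  rewrite ZT (pre_a'd' P) !inE eq_invg1 (negPf nt_z) /= => /eqP ezc.
  have Cc' x : (x \in 'C[c']) = (x \in 'C[z]) by rewrite -ezc !(cent1C x) groupV.
  case/negP: (unlink_ad L); rewrite cent1C eac Cc'.
  by rewrite (Cz _ _ (pre_dbz P)) // -Cc' (link_bc' L).
have nTU : T <> U :> {set gT}.
  move/val_inj=> eqTU; case/eqP: nac; apply/set1P.
  have: a \in 'Z(T) by rewrite eqTU.
  by rewrite ZT !inE (negPf nt_a).
pose V := (T :&: U)%G.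
have Va : a \in V by rewrite inE Ta.
have Vc' : c' \in V by rewrite inE Tc'.
have sVT : V \subset T by apply: subsetIl.
have sVU : V \subset U by apply: subsetIr.
pose V4 := [set 1; a; c'; a * c'].
have sV4 : V4 \subset V by rewrite !subUset !sub1set group1 Va Vc' groupM.
have oV4 : #|V4| = 4%N.
  have n1 : 1 != a * c'.
    rewrite eq_sym -eq_invg_mul; apply: contra nac => /eqP <-.
    by rewrite eq_sym eq_invg_mul -expg2 a2.
  have na : a != a * c' by rewrite -{1}(mulg1 a) (inj_eq (mulgI a)) eq_sym.
  have nc : c' != a * c' by rewrite -{1}(mul1g c') (inj_eq (mulIg c')) eq_sym.
  rewrite /V4 -!setUA cardsU1 cardsU1 cards2 !inE !negb_or nac n1 na nc.
  by rewrite ![1 == _]eq_sym nt_a nt_c'.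
have oV : #|V| = 4%N.
  have dvV : #|V| %| 8 by rewrite -oT cardSg.
  have nV8 : #|V| != 8%N.
    apply/eqP=> oV; case: nTU; apply/eqP; rewrite eqEcard oT oU leqnn andbT.
    have <- : V = T :> {set gT} by apply/eqP; rewrite eqEcard sVT oT oV.
    by [].
  move: (subset_leq_card sV4) (@dvdn_leq _ 8 isT dvV); move: dvV nV8; rewrite oV4.
  by case: #|V| => [|[|[|[|[|[|[|[|[]]]]]]]]].
have defV v : v \in V -> [\/ v = 1, v = a, v = c' | v = a * c'].
  have -> : V = V4 :> {set gT}.
    by apply/esym/eqP; rewrite eqEcard sV4 oV4 oV.
  rewrite !inE -!orbA => /or4P[] /eqP; by [constructor 1|constructor 2 | constructor 3 | constructor 4].
have abV : abelian V by apply: (@card_p2group_abelian _ 2).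
(* V has index 2 in T and in U, and T <*> U has order 24. *)
have nVG : G \subset 'N(V).
  have index2_norm (W : {group gT}) : #|W| = 8%N -> V \subset W -> W \subset 'N(V).
    move=> oW sVW; apply/normal_norm/index2_normal => //.
    by apply/eqP; rewrite -(eqn_pmul2l (cardG_gt0 V)) Lagrange // oW oV.
  have sJG : T <*> U \subset G by rewrite join_subG !subsetIl.
  have -> : G = (T <*> U)%G.
    apply/val_inj/esym/eqP; rewrite eqEcard sJG oG /=.
    have [k ek] : exists k, #|T <*> U| = (8 * k)%N.
      by exists #|T <*> U : T|; rewrite -oT Lagrange ?joing_subl.
    have nk1 : k <> 1%N.
      move=> k1; case: nTU; apply/esym/eqP; rewrite eqEcard oT oU leqnn andbT.
      have -> : T = (T <*> U)%G :> {set gT}.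
        by apply/eqP; rewrite eqEcard joing_subl ek k1 oT.
      by rewrite joing_subr.
    have := cardSg sJG; have := cardG_gt0 (T <*> U); rewrite oG ek.
    rewrite -[24%N]/(8 * 3)%N dvdn_pmul2l // leq_mul2l /=.
    by case: k {ek} nk1 => [|[|[|k]]].
  by rewrite join_subG !index2_norm.
have Vz : z \in V.
  rewrite -groupV -(pre_ad P) cmt_conj groupM // memJ_norm ?groupV //.
  by rewrite (subsetP nVG) ?groupV.
have inV x : x \in G -> x \in 'C[a] -> x \in 'C[c'] -> x \in V.
  by move=> Gx xa xc; rewrite !in_setI Gx xa xc.
have comV x y : x \in V -> y \in V -> x \in 'C[y].
  by move=> Vx Vy; apply/cent1P; apply: (centsP abV).
(* An element acting on V as the transvection that fixes a, or c', can only
   centralize z if z is that element. *)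
have fixU x : x \in 'C[a] -> x \in 'C[z] -> x \in 'C[c'] \/ z = a.
  move=> xa; case: (defV z Vz) => [z1 | -> | -> | ->]; auto.
    by rewrite z1 eqxx in nt_z.
  by rewrite cent1_mull //; left.
have fixT x : x \in 'C[c'] -> x \in 'C[z] -> x \in 'C[a] \/ z = c'.
  move=> xa; case: (defV z Vz) => [z1 | -> | -> | ->]; auto.
    by rewrite z1 eqxx in nt_z.
  by move: (comV a c' Va Vc') => /cent1P ->; rewrite cent1_mull //; left.
(* If b centralizes V, then c, which centralizes z, does not centralize V. So
   z = a, and d centralizes a because d * b and b centralize z. *)
have [ba | nba] := boolP (b \in 'C[a]).
  have Vb := inV b Gb ba (link_bc' L).
  have ca : c \in 'C[a] by rewrite cent1C (link_ac L).
  have [cc' | za] := fixU c ca (Cz _ _ (pre_caz P) (comV _ _ Va Vz)).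
    by case/negP: (unlink_bc L); apply: comV Vb (inV c Gc ca cc').
  case/negP: (unlink_ad L); rewrite cent1C -za.
  by rewrite (Cz _ _ (pre_dbz P)) ?comV.
(* Otherwise b maps a to a * c', and d' centralizes both. *)
have d'c' : d' \in 'C[c'].
  have: a ^ b^-1 \in V by rewrite memJ_norm // (subsetP nVG) ?groupV.
  have d'ab : d' \in 'C[a ^ b^-1].
    rewrite cent1C groupJ ?groupV ?(link_ad' L) ?(link_bd' L) //.
  case/defV=> eab.
  - by case/eqP: nt_a; apply: (conjg_inj b^-1); rewrite eab conj1g.
  - by case/negP: nba; rewrite -groupV; apply/cent1P/commute_sym/commgP/conjg_fixP.
  - case/eqP: nac; rewrite -(conjgKV b a) eab; apply/conjg_fixP/commgP/commute_sym.
    by apply/cent1P; rewrite (link_bc' L).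
  - by rewrite eab cent1_mull // in d'ab; rewrite cent1C (link_ad' L).
(* If d' centralizes V, then a', which centralizes z, does not centralize V. So
   z = c', and b' centralizes c' because d' * b' and d' centralize z. *)
have Vd' : d' \in V by rewrite inV // cent1C (link_ad' L).
have na'a : a' \notin 'C[a].
  apply: contra (unlink_a'd' L) => a'a.
  exact: comV (inV a' Ga' a'a (link_a'c' L)) Vd'.
have a'z : a' \in 'C[z].
  by rewrite -(groupMl _ (comV _ _ Vc' Vz)); apply/cent1P/(pre_c'a'z P).
have [a'a | zc'] := fixT a' (link_a'c' L) a'z; first by case/negP: na'a.
case/negP: (unlink_b'c' L); rewrite -zc' -(groupMl _ (comV _ _ Vd' Vz)).
exact/cent1P/(pre_d'b'z P).
Qed.

(** * Structures on groups of order 32 *)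

Lemma morph_prestructure (gT rT : finGroupType) (D : {group gT})
    (f : {morphism D >-> rT}) (z a b c d a' b' c' d' : gT) :
    z \in D ->
    [/\ a \in D, b \in D, a' \in D & b' \in D] ->
    [/\ c \in D, d \in D, c' \in D & d' \in D] ->
    prestructure z a b c d a' b' c' d' ->
  prestructure (f z) (f a) (f b) (f c) (f d) (f a') (f b') (f c') (f d').
Proof.
move=> Dz [Da Db Da' Db'] [Dc Dd Dc' Dd'].
have morph_cmt x y : x \in D -> y \in D -> f (cmt x y) = cmt (f x) (f y).
  by move=> Dx Dy; rewrite /cmt !morphM ?morphV ?groupM ?groupV.
have morph_commute x y : x \in D -> y \in D -> commute x y -> commute (f x) (f y).
  by move=> Dx Dy xy; rewrite /commute -!morphM // xy.
by case=> *; split; rewrite -?morph_cmt -?morphV -?morphM ?groupM ?groupV //;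
  try (by apply: morph_commute; rewrite ?groupM); congr (f _).
Qed.

Lemma prestructure_central (gT : finGroupType) (G : {group gT})
    (z a b c d a' b' c' d' : gT) :
    prestructure z a b c d a' b' c' d' -> z != 1 -> z \in G ->
    [/\ a \in G, b \in G, a' \in G & b' \in G] ->
    [/\ c \in G, d \in G, c' \in G & d' \in G] ->
  #|G| = 32%N -> 'Z(G) = [set 1; z].
Proof.
move=> P nt_z Gz Gabs Gcds oG.
have L := prestructure_linked P nt_z.
have Zz : z \in 'Z(G).
  (* If z is not central, the image of the relations in G / 'Z(G) contradicts
     prestructure_card. *)
  apply: contraTT isT => nZz.
  have nZ x : x \in G -> x \in 'N('Z(G)).
    by apply/subsetP/normal_norm/center_normal.
  have P' : prestructure (coset 'Z(G) z) (coset 'Z(G) a) (coset 'Z(G) b)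
     (coset 'Z(G) c) (coset 'Z(G) d) (coset 'Z(G) a') (coset 'Z(G) b')
     (coset 'Z(G) c') (coset 'Z(G) d').
    apply: morph_prestructure P; first exact: nZ.
      by case: Gabs => *; split; apply: nZ.
    by case: Gcds => *; split; apply: nZ.
  have: (32 <= #|G / 'Z(G)|)%N.
    apply: prestructure_card P' _ _ _.
    - by apply: contra nZz => /eqP; apply: coset_idr (nZ z Gz).
    - by case: Gabs => *; split; apply: mem_quotient.
    - by case: Gcds => *; split; apply: mem_quotient.
  rewrite leqNgt card_quotient ?normal_norm ?center_normal // -oG.
  rewrite -divgS ?center_sub // ltn_Pdiv ?cardG_gt0 // cardG_gt1.
  apply: contraTneq isT => Z1.
  have pG : 2.-group G by rewrite /pgroup oG.
  have := trivg_center_pgroup pG Z1.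
  by move/(congr1 (fun A : {set gT} => #|A|)); rewrite oG cards1.
case: Gabs Gcds => Ga Gb Ga' Gb' [Gc Gd Gc' Gd'].
exact: (linked_center L Ga Gb Ga' Gb' Gc Gd Gc' Gd' oG Zz nt_z).
Qed.

Section Relations.

Variables (gT : finGroupType) (G : {group gT}) (b : nat) (S : ddkTuple gT b).
Let z := ddk_z S.

Definition ddk_in : bool :=
  [&& [forall j, ddk_r1 S j \in G], [forall j, ddk_t1 S j \in G],
      [forall j, ddk_r2 S j \in G], [forall j, ddk_t2 S j \in G] & z \in G].

Lemma ddk_generated_sub : (ddk_generated S \subset G) = ddk_in.
Proof.
rewrite /ddk_in gen_subG !subUset sub1set /= -/z.
have imP (f : {ffun 'I_b -> gT}) :
  ([set f j | j : 'I_b] \subset G) = [forall j, f j \in G].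
  apply/subsetP/forallP=> [sfG j | Gf _ /imsetP[j _ ->] //].
  by rewrite sfG ?imset_f.
by rewrite !imP -!andbA; do !bool_congr.
Qed.

Lemma ddk_prestructure (j k : 'I_b) :
    r1_action_relations S -> t1_action_relations S -> (j < k)%N ->
  prestructure z (ddk_r1 S j) (ddk_t1 S j) (ddk_r2 S j) (ddk_t2 S j)
                 (ddk_r1 S k) (ddk_t1 S k) (ddk_r2 S k) (ddk_t2 S k).
Proof.
move=> Rr Rt ltjk.
have conj_eq x y : cmt x z = cmt y^-1 z -> commute (y * x) z.
  rewrite /cmt => /mulIg; rewrite invgK => /(congr1 (fun w => y * w * x)).
  by rewrite !mulgA mulgKV mulgV mul1g /commute !mulgA.
have Rjk := forallP (forallP Rr j) k; have Rkj := forallP (forallP Rr k) j.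
have Tjk := forallP (forallP Rt j) k; have Tkj := forallP (forallP Rt k) j.
move: Rjk Rkj Tjk Tkj; rewrite ltjk /= -!/z.
case/and5P=> e1 e2 _ e3 /andP[/eqP e4 /andP[_ /eqP e5]].
case/and5P=> _ e6 _ _ /andP[/eqP e7 /andP[_ /eqP e8]].
case/and5P=> f1 /eqP f2 _ f3 /and3P[f4 _ /eqP f5].
case/and5P=> _ /eqP f6 _ _ /and3P[f7 _ /eqP f8].
by split=> //; [exact/cmtP | exact/cmtP | exact/cmtP | exact/cmtP | exact/cmtP
  | exact/cmtP | exact: conj_eq..].
Qed.

End Relations.

Section Central.

Variables (gT : finGroupType) (G : {group gT}) (b : nat) (S : ddkTuple gT b).
Let z := ddk_z S.

(** What remains of the conjugacy relations when z is central: r1 is dual to t2,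
    and t1 to r2. *)
Definition dual_pairing : bool :=
  [forall j : 'I_b, forall k : 'I_b,
    [&& cmt (ddk_r1 S j) (ddk_r2 S k) == 1,
        cmt (ddk_r1 S j) (ddk_t2 S k) == (if j == k then z^-1 else 1),
        cmt (ddk_t1 S j) (ddk_r2 S k) == (if j == k then z else 1)
      & cmt (ddk_t1 S j) (ddk_t2 S k) == 1]].

Lemma ddk_inP : reflect
  [/\ forall j, ddk_r1 S j \in G, forall j, ddk_t1 S j \in G,
      forall j, ddk_r2 S j \in G, forall j, ddk_t2 S j \in G & z \in G]
  (ddk_in G S).
Proof.
by apply: (iffP and5P) => -[? ? ? ? ?]; split=> //; apply/forallP.
Qed.

Lemma central_action_relations : ddk_in G S -> z \in 'Z(G) ->
  r1_action_relations S && t1_action_relations S = dual_pairing.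
Proof.
case/ddk_inP=> Gr1 Gt1 Gr2 Gt2 Gz /centerP[_ cz].
have zK x : x \in G -> z^-1 * x * z = x.
  by move=> Gx; rewrite -mulgA -cz // mulKg.
have Kz x : x \in G -> x^-1 * z * x = z.
  by move=> Gx; rewrite -mulgA cz // mulKg.
have r_r x y : x \in G -> y \in G -> z^-1 * x * y^-1 * z * y * x^-1 = 1.
  move=> Gx Gy; rewrite -(mulgA z^-1) zK ?groupM ?groupV //.
  by rewrite mulgKV mulgV.
have t_t x y : x \in G -> y \in G ->
    y^-1 * z * y * z^-1 * x * z * y^-1 * z^-1 * y * x^-1 = 1.
  move=> Gx Gy; have KzV w : y^-1 * (z^-1 * (y * w)) = z^-1 * w.
    have -> : z^-1 * (y * w) = y * (z^-1 * w) 
      by rewrite !mulgA; congr (_ * w); apply: (mulIg z); rewrite zK // mulgKV.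
    by rewrite mulKg.
  by rewrite Kz // mulgV mul1g -!mulgA KzV mulKVg mulgV.
have cmt_z x : x \in G -> cmt x z = 1.
  by move=> Gx; apply/eqP/cmtP/commute_sym/cz.
have cmt_zV x : x \in G -> cmt z^-1 x = 1.
  by move=> Gx; apply/eqP/cmtP/commute_sym/commuteV/commute_sym/cz.
apply/andP/forallP => [[/forallP Rr /forallP Rt] j | R].
  apply/forallP=> k.
  have := forallP (Rr j) k; have := forallP (Rt j) k; rewrite -!/z.
  rewrite r_r // t_t // !cmt_z ?groupV // cmt_zV //.
  rewrite eqxx andbT -val_eqE; case: ltngtP => [_ | _ | /val_inj->] /=.
  - by case/and4P=> ? _ ? _ /and4P[? _ ? _]; apply/and4P.
  - by case/and4P=> _ ? _ ? /and5P[_ ? _ ? _]; apply/and4P.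
  - by rewrite Kz // => /and3P[? ? _] /and3P[? ? _]; apply/and4P.
split; apply/forallP=> j; apply/forallP=> k; rewrite -!/z.
  rewrite r_r // !cmt_z ?groupV // cmt_zV //.
  have /and4P[-> e _ _] := forallP (R j) k.
  have /and4P[-> + _ _] := forallP (R j) j.
  move: e; rewrite eqxx -val_eqE /= => + ->.
  by case: ltngtP => //= _ ->; rewrite eqxx.
rewrite t_t // Kz // !cmt_z ?groupV //.
have /and4P[_ _ e ->] := forallP (R j) k.
have /and4P[_ _ + ->] := forallP (R j) j.
move: e; rewrite eqxx -val_eqE /= => + ->.
by case: ltngtP => //= _ ->; rewrite eqxx.
Qed.

End Central.

Section Strong.

Variables (gT : finGroupType) (G : {group gT}) (b : nat) (S : ddkTuple gT b).
Let z := ddk_z S.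
Hypotheses (b_ge2 : (2 <= b)%N) (SG : ddk_in G S) (nt_z : z != 1).
Hypotheses (Rr : r1_action_relations S) (Rt : t1_action_relations S).

Let j0 : 'I_b := Ordinal (ltnW b_ge2).
Let j1 : 'I_b := Ordinal b_ge2.

Lemma ddk_prestructure01 :
  prestructure z (ddk_r1 S j0) (ddk_t1 S j0) (ddk_r2 S j0) (ddk_t2 S j0)
                 (ddk_r1 S j1) (ddk_t1 S j1) (ddk_r2 S j1) (ddk_t2 S j1).
Proof. exact: ddk_prestructure. Qed.

Lemma ddk_card_ge32 : (32 <= #|G|)%N.
Proof.
case/ddk_inP: SG => Gr1 Gt1 Gr2 Gt2 _.
by apply: prestructure_card ddk_prestructure01 nt_z _ _.
Qed.

Hypothesis oG : #|G| = 32%N.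

Lemma ddk_center : 'Z(G) = [set 1; z].
Proof.
case/ddk_inP: SG => Gr1 Gt1 Gr2 Gt2 Gz.
by apply: prestructure_central ddk_prestructure01 _ _ _ _ oG.
Qed.

Lemma ddk_z_central : z \in 'Z(G).
Proof. by rewrite ddk_center !inE eqxx orbT. Qed.

(** The chain of centralizers taken inside K1, or its dual inside K2, ends with
    a group that contains z, so K1 and K2 have order at least 32. *)
Lemma ddk_order32_strong : ddk_strong G S.
Proof.
case/ddk_inP: SG => Gr1 Gt1 Gr2 Gt2 Gz.
have L := prestructure_linked ddk_prestructure01 nt_z.
have cz x : x \in G -> z \in 'C[x].
  by case/centerP: ddk_z_central => _ cz Gx; apply/cent1P/cz.
split; apply/val_inj/eqP; rewrite eqEcard oG /= gen_subG !subUset sub1set Gz /=.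
  apply/andP; split.
    by apply/andP; split; apply/subsetP=> _ /imsetP[j _ ->].
  apply: (@linked_card_ge32 _ (ddk_K1 S) _ _ _ _ _ _ _ _ L _ _ _ _ z) => //;
    try by rewrite mem_gen // !inE ?eqxx ?imset_f ?orbT.
  by split; apply: cz.
apply/andP; split.
  by apply/andP; split; apply/subsetP=> _ /imsetP[j _ ->].
apply: (@linked_card_ge32 _ (ddk_K2 S) _ _ _ _ _ _ _ _ (linked_dual L) _ _ _ _ z) => //;
  try by rewrite mem_gen // !inE ?eqxx ?imset_f ?orbT.
by split; apply: cz.
Qed.

(** Both K1 and K2 are equal to G and they commute modulo 'Z(G) = {1, z}, so
    G / 'Z(G) is abelian; it has exponent 2 since commutators are central of
    order at most 2. *)
Lemma ddk_order32_extraspecial : extraspecial G.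
Proof.
case/ddk_inP: (SG) => Gr1 Gt1 Gr2 Gt2 Gz.
have pG : 2.-group G by rewrite /pgroup oG.
have nZG : G \subset 'N('Z(G)) by rewrite normal_norm ?center_normal.
have oZ : #|'Z(G)| = 2%N by rewrite ddk_center cards2 eq_sym nt_z.
have := central_action_relations SG ddk_z_central.
rewrite Rr Rt => /esym/forallP dualS.
have [K1G K2G] := ddk_order32_strong.
have genZ : [~: ddk_K1 S, ddk_K2 S] \subset 'Z(G).
  have nZ x : x \in G -> x \in 'N('Z(G)) by apply: subsetP.
  rewrite -quotient_cents2; try by rewrite ?K1G ?K2G.
  have sgen (f g : {ffun 'I_b -> gT}) : (forall j, f j \in G) -> (forall j, g j \in G) ->
      z |: ([set f j | j : 'I_b] :|: [set g j | j : 'I_b]) \subset 'N('Z(G)).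
    move=> Gf Gg; rewrite subUset sub1set nZ //=; apply/subsetP=> x.
    by case/setUP=> /imsetP[j _ ->]; rewrite nZ.
  rewrite !quotient_gen ?sgen // cent_gen gen_subG quotient_cents2 ?sgen //.
  rewrite gen_subG; apply/subsetP=> _ /imset2P[x y K1x K2y ->].
  have cmtJ : [~ x, y] = cmt x y ^ (x * y).
    by rewrite /cmt commgEl !conjgE !invMg !mulgA mulgKV mulVg mul1g.
  have memZ x1 y1 : x1 \in G -> y1 \in G -> cmt x1 y1 \in 'Z(G) ->
      cmt x1 y1 ^ (x1 * y1) \in 'Z(G).
    by move=> Gx1 Gy1; rewrite memJ_norm // nZ // groupM.
  have cmt1 x1 y1 : x1 \in G -> y1 \in G -> (x1 == z) || (y1 == z) -> cmt x1 y1 = 1.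
    case/centerP: ddk_z_central => _ cz Gx1 Gy1 xy; apply/eqP/cmtP.
    by case/orP: xy => /eqP->; [|apply: commute_sym]; apply: cz.
  rewrite {}cmtJ.
  case/setU1P: K1x => [-> | /setUP[/imsetP[j _ ->] | /imsetP[j _ ->]]];
  case/setU1P: K2y => [-> | /setUP[/imsetP[k _ ->] | /imsetP[k _ ->]]];
    apply: memZ => //; try (by rewrite cmt1 ?eqxx ?orbT // group1);
    have /and4P[/eqP e1 /eqP e2 /eqP e3 /eqP e4] := forallP (dualS j) k;
    rewrite ?e1 ?e2 ?e3 ?e4; try case: ifP => _;
    by rewrite ?groupV ?group1 ?ddk_z_central.
have cG x y : x \in G -> y \in G -> [~ x, y] \in 'Z(G).
  by move=> Gx Gy; apply: (subsetP genZ); rewrite mem_commg ?K1G ?K2G.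
apply/(extraspecialP _ pG) => //; split=> //.
- by rewrite prime_cyclic ?oZ.
- apply/(abelemP _) => //; split.
    apply/centsP=> _ /morphimP[x Nx Gx ->] _ /morphimP[y Ny Gy ->].
    apply/commgP; rewrite -morphR //; apply/eqP/coset_id; exact: cG.
  move=> _ /morphimP[x Nx Gx ->]; rewrite -morphX //; apply: coset_id.
  apply/centerP; split=> [|y Gy]; first exact: groupX.
  apply/commgP.
  have /centerP[_ cxy] := cG x y Gx Gy; have cx := cxy x Gx.
  rewrite commXg; last by apply/commute_sym; rewrite /commute -cxy.
  have: [~ x, y] \in 'Z(G) by apply: cG.
  by move/expg_cardG; rewrite oZ => ->.
- rewrite trivg_card1 card_quotient // -divgS ?center_sub //.
  by rewrite oG oZ.
Qed.

End Strong.

(** * Frames and normal forms *)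

Notation vec := (bool * bool * bool * bool)%type.

Definition vadd (v w : vec) : vec :=
  (v.1.1.1 (+) w.1.1.1, v.1.1.2 (+) w.1.1.2, v.1.2 (+) w.1.2, v.2 (+) w.2).

(** The power of z produced by collecting the product of e ^+ i * f ^+ j and
    e ^+ k * f ^+ l, when e, f have squares z ^+ p, z ^+ q and commutator z. *)
Definition plane_cocycle (p q i j k l : bool) : bool :=
  (j && k) (+) (i && k && p) (+) (j && l && q).

Definition cocycle (q v w : vec) : bool :=
  plane_cocycle q.1.1.1 q.1.1.2 v.1.1.1 v.1.1.2 w.1.1.1 w.1.1.2
  (+) plane_cocycle q.1.2 q.2 v.1.2 v.2 w.1.2 w.2.

Definition alt_form (v w : vec) : bool :=
  (v.1.1.1 && w.1.1.2) (+) (v.1.1.2 && w.1.1.1)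
  (+) ((v.1.2 && w.2) (+) (v.2 && w.1.2)).

Lemma cocycle_sym q v w : cocycle q v w (+) cocycle q w v = alt_form v w.
Proof.
have planeC (p r i j k l : bool) :
    plane_cocycle p r i j k l (+) plane_cocycle p r k l i j = (i && l) (+) (j && k).
  by move: p r i j k l => [] [] [] [] [] [].
by rewrite /cocycle addbACA !planeC.
Qed.

(** For z of order 2, the vectors (1,0,0,0), ..., (0,0,0,1) given by e1, f1, e2,
    f2 form a symplectic basis modulo z; q records their squares. *)
Record frame (gT : finGroupType) (q : vec) (z e1 f1 e2 f2 : gT) : Prop := Frame {
  frame_zz : z * z = 1;
  frame_ze1 : commute z e1; frame_zf1 : commute z f1;
  frame_ze2 : commute z e2; frame_zf2 : commute z f2;
  frame_e1 : e1 * e1 = z ^+ q.1.1.1; frame_f1 : f1 * f1 = z ^+ q.1.1.2;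
  frame_e2 : e2 * e2 = z ^+ q.1.2;   frame_f2 : f2 * f2 = z ^+ q.2;
  frame_fe1 : f1 * e1 = e1 * f1 * z; frame_fe2 : f2 * e2 = e2 * f2 * z;
  frame_e1e2 : commute e1 e2; frame_e1f2 : commute e1 f2;
  frame_f1e2 : commute f1 e2; frame_f1f2 : commute f1 f2 }.

Lemma expg_addb (gT : finGroupType) (z : gT) (b c : bool) :
  z * z = 1 -> z ^+ (b (+) c) = z ^+ b * z ^+ c.
Proof. by case: b c => [] [] //= zz; rewrite ?mul1g ?mulg1. Qed.

Lemma mul_plane (gT : finGroupType) (z e f : gT) (p q i j k l : bool) :
    z * z = 1 -> commute z e -> commute z f ->
    e * e = z ^+ p -> f * f = z ^+ q -> f * e = e * f * z ->
  e ^+ i * f ^+ j * (e ^+ k * f ^+ l) = e ^+ (i (+) k) * f ^+ (j (+) l)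
    * z ^+ plane_cocycle p q i j k l.
Proof.
move=> zz ze zf ee ff fe; rewrite /plane_cocycle.
have sq x (a b r : bool) : x * x = z ^+ r ->
    x ^+ a * x ^+ b = x ^+ (a (+) b) * z ^+ (a && b && r).
  by case: a b => [] [] //=; rewrite ?mul1g ?mulg1.
have zX x (a b : bool) : commute z x -> z ^+ a * x ^+ b = x ^+ b * z ^+ a.
  by move=> zx; apply/commute_sym/commuteX/commute_sym/commuteX.
have fXeX : f ^+ j * e ^+ k = e ^+ k * f ^+ j * z ^+ (j && k).
  by case: j k => [] [] //=; rewrite ?mul1g ?mulg1.
rewrite mulgA -(mulgA _ (f ^+ j)) fXeX !mulgA (sq _ _ _ _ ee).
rewrite -!mulgA zX // (mulgA (f ^+ j)) (sq _ _ _ _ ff) !mulgA.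
rewrite -(mulgA (e ^+ _)) zX // -!mulgA !(expg_addb _ _ zz).
congr (_ * (_ * _)).
have zzX (a b : bool) : z ^+ a * z ^+ b = z ^+ b * z ^+ a by apply: zX.
by rewrite -!(expg_addb _ _ zz) addbA addbC addbA.
Qed.

Section Frame.

Variables (gT : finGroupType) (q : vec) (z e1 f1 e2 f2 : gT).
Hypothesis F : frame q z e1 f1 e2 f2.

Definition frame_word (m : vec * bool) : gT :=
  e1 ^+ m.1.1.1.1 * f1 ^+ m.1.1.1.2 * (e2 ^+ m.1.1.2 * f2 ^+ m.1.2) * z ^+ m.2.

Lemma wordM m n :
  frame_word m * frame_word n =
  frame_word (vadd m.1 n.1, m.2 (+) n.2 (+) cocycle q m.1 n.1).
Proof.
case: F => zz ze1 zf1 ze2 zf2 ee1 ff1 ee2 ff2 fe1 fe2 e1e2 e1f2 f1e2 f1f2.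
have zX x (a b : bool) : commute z x -> commute (z ^+ a) (x ^+ b).
  by move=> zx; apply/commuteX/commute_sym/commuteX/commute_sym.
have XX (x y : gT) (a b : bool) : commute x y -> commute (x ^+ a) (y ^+ b).
  by move=> xy; apply/commuteX/commute_sym/commuteX/commute_sym.
have shuffle (A B A' B' u v : gT) : commute u A' -> commute u B' -> commute B A' ->
    A * B * u * (A' * B' * v) = A * A' * (B * B') * (u * v).
  move=> uA' uB' BA'; rewrite -!mulgA; congr (_ * _).
  by rewrite (mulgA u A') uA' -mulgA (mulgA B) BA' -mulgA (mulgA u B') uB' -mulgA.
case: m n => [[[[i j] k] l] s] [[[[i' j'] k'] l'] s']; rewrite /frame_word /=.
set A := e1 ^+ i * f1 ^+ j; set B := e2 ^+ k * f2 ^+ l.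
set A' := e1 ^+ i' * f1 ^+ j'; set B' := e2 ^+ k' * f2 ^+ l'.
have zA' (r : bool) : commute (z ^+ r) A' by apply: commuteM; apply: zX.
have zB' (r : bool) : commute (z ^+ r) B' by apply: commuteM; apply: zX.
have BA' : commute B A'.
  by apply/commute_sym/commuteM; apply/commute_sym/commuteM; apply: XX.
rewrite (shuffle _ _ _ _ _ _ (zA' s) (zB' s) BA') /A /B /A' /B'.
rewrite (mul_plane _ _ _ _ zz ze1 zf1 ee1 ff1 fe1).
rewrite (mul_plane _ _ _ _ zz ze2 zf2 ee2 ff2 fe2).
set u := plane_cocycle _ _ i _ _ _; set v := plane_cocycle _ _ k _ _ _.
rewrite [cocycle _ _ _](_ : _ = u (+) v) //.
rewrite (expg_addb (s (+) s') (u (+) v) zz) (expg_addb s s' zz) (expg_addb u v zz).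
have collect (x y r t w : gT) : commute r y -> commute w (r * t) ->
    x * r * (y * t) * w = x * y * (w * (r * t)).
  by move=> ry ->; rewrite -!mulgA (mulgA r y) ry -mulgA.
apply: collect; first by apply: commuteM; apply: zX.
by rewrite -!(expg_addb _ _ zz); apply: zX.
Qed.

Lemma word_z_in (K : {group gT}) : [/\ e1 \in K, f1 \in K, e2 \in K & f2 \in K] ->
  z \in K -> forall m, frame_word m \in K.
Proof. by case=> ? ? ? ? ? m; rewrite !groupM ?groupX. Qed.

Definition words : {set gT} := [set frame_word m | m : vec * bool].

Lemma words_group_set : group_set words.
Proof.
apply/group_setP; split.
  apply/imsetP; exists (false, false, false, false, false) => //.
  by rewrite /frame_word /= !mulg1.
by move=> _ _ /imsetP[m _ ->] /imsetP[n _ ->]; rewrite wordM imset_f.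
Qed.

Lemma words_gen :
  [/\ e1 \in words, f1 \in words, e2 \in words, f2 \in words & z \in words].
Proof.
split; apply/imsetP;
  [ exists (true, false, false, false, false)
  | exists (false, true, false, false, false)
  | exists (false, false, true, false, false)
  | exists (false, false, false, true, false)
  | exists (false, false, false, false, true)] => //;
  by rewrite /frame_word /= ?mulg1 ?mul1g.
Qed.

Lemma card_words_le : (#|words| <= 32)%N.
Proof.
by apply: leq_trans (leq_imset_card _ _) _; rewrite !card_prod card_bool.
Qed.

(** The chain of centralizers of e1, f1, e2, f2 is strict, with witnesses
    f1, e1, f2, e2. *)
Lemma frame_linked : z != 1 -> linked e2 f2 e2 f2 e1 f1 e1 f1.
Proof.
have nC e f : z != 1 -> f * e = e * f * z -> f \notin 'C[e].
  move=> nt_z fe; apply: contra nt_z => /cent1P fe'.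
  by apply/eqP/(mulgI (e * f)); rewrite -fe mulg1.
case: F => *; split; rewrite ?cent1id //; try exact/cent1P;
  try exact/cent1P/commute_sym; rewrite 1?cent1C; first [exact: nC | by rewrite cent1C; apply: nC].
Qed.

(** The chain of centralizers bounds the order of the group of all words from
    below; the injectivity of the normal form is a consequence. *)
Lemma card_words : z != 1 -> #|words| = 32%N.
Proof.
move=> nt_z; apply/eqP; rewrite eqn_leq card_words_le /=.
have [we1 wf1 we2 wf2 wz] := words_gen.
have cz x : x \in words -> z \in 'C[x].
  case/imsetP=> m _ ->; apply/cent1P.
  case: F => *; rewrite /frame_word; do !apply: commuteM; apply: commuteX => //.
apply: (@linked_card_ge32 _ (Group words_group_set) _ _ _ _ _ _ _ _
  (frame_linked nt_z) _ _ _ _ z) => //.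
by split; apply: cz.
Qed.

Lemma word_inj : z != 1 -> injective frame_word.
Proof.
move=> nt_z; apply: in2T; apply/imset_injP.
by rewrite -[imset _ _]/words card_words // !card_prod card_bool.
Qed.

(** Exchanging two words only changes the power of z in their product, by the
    difference of two values of the cocycle, which is alt_form. *)
Lemma word_comm m n : z != 1 -> (frame_word m \in 'C[frame_word n]) = ~~ alt_form m.1 n.1.
Proof.
move=> nt_z; have vaddC v w : vadd v w = vadd w v.
  by congr (_, _, _, _); apply: addbC.
rewrite -(cocycle_sym q).
apply/cent1P/idP; rewrite /commute !wordM vaddC (addbC n.2).
  move/(word_inj nt_z)/(congr1 snd) => /=.
  by case: (m.2 (+) n.2) (cocycle q m.1 _) (cocycle q n.1 _) => [] [] [].
by case: (cocycle q m.1 _) (cocycle q n.1 _) => [] [].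
Qed.

Lemma word_sq m : frame_word m * frame_word m = z ^+ cocycle q m.1 m.1.
Proof.
rewrite wordM; have -> : vadd m.1 m.1 = (false, false, false, false).
  by rewrite /vadd !addbb.
by rewrite addbb /frame_word /= !mul1g.
Qed.

End Frame.

Section ExtraspecialFrame.

Variables (gT : finGroupType) (G : {group gT}).
Hypotheses (oG : #|G| = 32%N) (esG : extraspecial G).

(** Centralizers of elements have index at most 2, as conjugacy classes lie in
    cosets of {1, z}. After the choice of a noncommuting pair e1, f1, the
    centralizer H of both has order at least 8, and a noncentral e2 of H has a
    noncommuting partner in H: otherwise the centralizer of e2, which contains
    H, e1 and f1, would be all of G. *)
Lemma extraspecial_frame : exists q z e1 f1 e2 f2,
  [/\ frame q z e1 f1 e2 f2, z != 1, 'Z(G) = [set 1; z]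
    & [/\ e1 \in G, f1 \in G, e2 \in G & f2 \in G]].
Proof.
have pG : 2.-group G by rewrite /pgroup oG.
have [_ oZ abGZ _] := (extraspecialP (isT : prime 2) pG).1 esG.
have nZG : G \subset 'N('Z(G)) by rewrite normal_norm ?center_normal.
have /trivgPn[z Zz nt_z] : 'Z(G) != 1 by rewrite -cardG_gt1 oZ.
have defZ : 'Z(G) = [set 1; z].
  apply/esym/eqP; rewrite eqEcard subUset !sub1set group1 Zz /=.
  by rewrite cards2 eq_sym nt_z oZ.
have /centerP[Gz cz] := Zz.
have zz : z * z = 1 by move: (expg_cardG Zz); rewrite oZ.
have sq x : x \in G -> x * x = z ^+ (x * x != 1).
  move=> Gx; have: x ^+ 2 \in 'Z(G).
    have Nx := subsetP nZG x Gx.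
    apply: coset_idr; rewrite ?groupX // morphX //.
    by case/(abelemP (isT : prime 2)): abGZ => _; apply; apply: mem_quotient.
  by rewrite defZ !inE expg2 => /orP[]/eqP->; rewrite ?eqxx ?nt_z.
have anti x y : x \in G -> y \in G -> y \notin 'C[x] -> y * x = x * y * z.
  move=> Gx Gy nxy; have: [~ y, x] \in 'Z(G).
    case: esG => [[_ <-]] _; exact: mem_commg.
  rewrite defZ !inE (commgC y x) => /orP[|/eqP-> //] /commgP yx.
  by case/negP: nxy; apply/cent1P.
have noncentral x : x \in G -> x \notin 'Z(G) -> exists2 y, y \in G & y \notin 'C[x].
  move=> Gx; rewrite in_setI Gx /= -sub_cent1 => /subsetPn[y Gy ny].
  by exists y.
have large x : x \in G -> (16 <= #|'C_G[x]|)%N.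
  move=> Gx; have: (#|G : 'C_G[x]| <= 2)%N.
    rewrite index_cent1; apply: (@leq_trans #|[set x; (x * z)%g]|); last first.
      by rewrite cards2; case: eqP.
    apply/subset_leq_card/subsetP=> _ /imsetP[y Gy ->].
    have [yx | nyx] := boolP (y \in 'C[x]).
      have /conjg_fixP-> : [~ x, y] == 1 by apply/commgP/commute_sym/cent1P.
      by rewrite !inE eqxx.
    apply/set2P; right; have := anti y x Gy Gx; rewrite cent1C => /(_ nyx) e.
    by rewrite conjgE e -!mulgA mulKg.
  have fac c i : (c * i = 32 -> i <= 2 -> 16 <= c)%N by nia.
  by apply: fac; rewrite Lagrange ?subsetIl.
have gtC x y : x \in G -> y \in G -> (8 <= #|'C_G[x] :&: 'C_G[y]|)%N.
  move=> Gx Gy; have := mul_cardG 'C_G[x] 'C_G[y].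
  have: (#|('C_G[x] * 'C_G[y])%g| <= 32)%N.
    by rewrite -oG subset_leq_card // mul_subG ?subsetIl.
  have := leq_mul (large x Gx) (large y Gy).
  have fac p m i : (16 * 16 <= p -> m <= 32 -> p = m * i -> 8 <= i)%N by nia.
  exact: fac.
have pick (H : {group gT}) : H \subset G -> (8 <= #|H|)%N ->
    exists2 x, x \in H & x \notin 'Z(G).
  move=> sHG oH; apply/subsetPn; apply: contraL oH => /subset_leq_card.
  by rewrite oZ -ltnNge => /leq_ltn_trans->.
have [|e1 Ge1 nZe1] := pick G (subxx G); first by rewrite oG.
have [f1 Gf1 nef1] := noncentral e1 Ge1 nZe1.
pose H := ('C_G[e1] :&: 'C_G[f1])%G.
have sHG : H \subset G by rewrite /= -setIA subsetIl.
have [e2 He2 nZe2] := pick H sHG (gtC _ _ Ge1 Gf1).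
have memH x : x \in H -> [/\ x \in G, x \in 'C[e1] & x \in 'C[f1]].
  by case/setIP=> /setIP[Gx xe] /setIP[_ xf].
have [Ge2 e2e1 e2f1] := memH e2 He2.
have [f2 Hf2 nef2] : exists2 f2, f2 \in H & f2 \notin 'C[e2].
  apply/subsetPn; apply: contra nZe2 => sHC.
  pose K := 'C_G[e2]%G.
  have Ke1 : e1 \in K by rewrite inE Ge1 cent1C.
  have Kf1 : f1 \in K by rewrite inE Gf1 cent1C.
  have [m1 g1 c1] := cent1_step Kf1 nef1.
  have [||m2 g2 c2] := @cent1_step _ 'C_K[e1]%G f1 e1.
  - by rewrite inE Ke1 cent1id.
  - by rewrite cent1C.
  have sHK : H \subset 'C_K[e1] :&: 'C[f1].
    apply/subsetP=> x Hx; have [Gx xe xf] := memH x Hx.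
    by rewrite !in_setI Gx xe xf (subsetP sHC).
  have oK : (32 <= #|K|)%N.
    rewrite c1 c2 -[32%N]/(2 * (2 * 8))%N; apply: leq_mul g1 (leq_mul g2 _).
    exact: leq_trans (gtC _ _ Ge1 Gf1) (subset_leq_card sHK).
  have KG : K = G :> {set gT} by apply/eqP; rewrite eqEcard subsetIl oG.
  by rewrite inE Ge2 -sub_cent1 -{1}KG subsetIr.
have [Gf2 f2e1 f2f1] := memH f2 Hf2.
exists (e1 * e1 != 1, f1 * f1 != 1, e2 * e2 != 1, f2 * f2 != 1).
exists z, e1, f1, e2, f2; split=> //.
by split=> //; rewrite /=; try exact: sq; try exact: cz; try exact: anti;
  try exact/cent1P; apply/cent1P; rewrite cent1C.
Qed.

End ExtraspecialFrame.

(** * Structures of type (2, 2) in a framed group *)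

Section FramedStructures.

Variables (gT : finGroupType) (G : {group gT}).
Variables (q : vec) (z e1 f1 e2 f2 : gT).
Hypotheses (F : frame q z e1 f1 e2 f2) (nt_z : z != 1).
Hypotheses (oG : #|G| = 32%N).
Hypotheses (GF : [/\ e1 \in G, f1 \in G, e2 \in G & f2 \in G]).

Local Notation word := (frame_word z e1 f1 e2 f2).

Lemma frame_z_in : z \in G.
Proof.
have -> : z = (e1 * f1)^-1 * (f1 * e1) by rewrite (frame_fe1 F) mulKg.
by case: GF => *; rewrite groupM ?groupV ?groupM.
Qed.

Lemma words_full : words z e1 f1 e2 f2 = G.
Proof.
apply/eqP; rewrite eqEcard (card_words F nt_z) oG leqnn andbT.
by apply/subsetP=> _ /imsetP[m _ ->]; apply: word_z_in GF frame_z_in m.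
Qed.

Lemma wordP x : reflect (exists m, x = word m) (x \in G).
Proof.
rewrite -words_full; apply: (iffP imsetP) => [[m _ ->] | [m ->]]; by exists m.
Qed.

Lemma word_in m : word m \in G.
Proof. by apply/wordP; exists m. Qed.

Lemma frame_z_central : z \in 'Z(G).
Proof.
apply/centerP; split=> [|_ /wordP[m ->]]; first exact: frame_z_in.
by case: F => *; rewrite /frame_word; do !apply: commuteM; apply: commuteX.
Qed.

Lemma frame_center : 'Z(G) = [set 1; z].
Proof.
case: GF => Ge1 Gf1 Ge2 Gf2.
exact: (linked_center (frame_linked F nt_z) Ge2 Gf2 Ge1 Gf1 Ge2 Gf2 Ge1 Gf1
  oG frame_z_central nt_z).
Qed.

Lemma cmt_pow x y : x \in G -> y \in G -> cmt x y = z ^+ (x \notin 'C[y]).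
Proof.
case/wordP=> m -> /wordP[n ->].
have [xy | nxy] := boolP (word m \in 'C[word n]).
  by apply/eqP; rewrite cmt_eq1.
apply/(mulIg (word n))/(mulIg (word m)); rewrite /cmt !mulgKV.
have wz v s : word (v, ~~ s) = z * word (v, s).
  have [ze1 zf1 ze2 zf2] : [/\ commute z e1, commute z f1, commute z e2 & commute z f2].
    by case: F.
  have -> : z * word (v, s) = word (v, s) * z.
    by rewrite /frame_word; do !apply: commuteM; apply: commuteX.
  rewrite /frame_word -[RHS]mulgA; congr (_ * _).
  by case: s; rewrite /= ?mul1g ?(frame_zz F).
move: nxy; rewrite (word_comm F) // negbK -[RHS]mulgA.
rewrite !(wordM F) => fmn; rewrite expg1 -wz.
have -> : vadd m.1 n.1 = vadd n.1 m.1 by congr (_, _, _, _); apply: addbC.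
congr (word (_, _)); rewrite (addbC m.2).
have : cocycle q m.1 n.1 (+) cocycle q n.1 m.1.
  by rewrite cocycle_sym.
by case: (_ (+) _) (cocycle q m.1 _) (cocycle q n.1 _) => [] [] [].
Qed.

(** The relations of a structure of type (2, 2) expressed by noncommutation
    only; the last two conditions are the surface relations, where the factors
    t1, or t2, cancel and a product of two commutators remains. *)
Definition dual_bases (S : ddkTuple gT 2) : bool :=
  let nc x y := x \notin 'C[y] in
  let r1 := ddk_r1 S in let t1 := ddk_t1 S in
  let r2 := ddk_r2 S in let t2 := ddk_t2 S in
  [&& [forall j : 'I_2, forall k : 'I_2,
        [&& ~~ nc (r1 j) (r2 k), nc (r1 j) (t2 k) == (j == k),
            nc (t1 j) (r2 k) == (j == k) & ~~ nc (t1 j) (t2 k)]],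
      nc (r1 ord0) (t1 ord0) (+) nc (r1 ord_max) (t1 ord_max)
    & nc (r2 ord0) (t2 ord0) (+) nc (r2 ord_max) (t2 ord_max)].

Lemma pow_z_inj (b c : bool) : (z ^+ b == z ^+ c) = (b == c).
Proof.
by case: b c => [] []; rewrite /= ?eqxx //= ?(negPf nt_z) // eq_sym (negPf nt_z).
Qed.

(** A structure has z as its last component because that component is the
    nontrivial central element of G; conversely the relations imply that K1,
    hence the whole structure, generates G. *)
Lemma structures_frameE (S : ddkTuple gT 2) :
  is_ddk G 2 S = [&& ddk_in G S, ddk_z S == z & dual_bases S].
Proof.
have zV : z^-1 = z by apply/eqP; rewrite eq_invg_mul (frame_zz F).
have o_z : #[z] = 2%N by apply: nt_prime_order; rewrite // expg2 (frame_zz F).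
have relE : ddk_in G S -> ddk_z S = z ->
    [&& surface_relations S, r1_action_relations S & t1_action_relations S]
      = dual_bases S.
  move=> SG Sz; rewrite (central_action_relations SG) ?Sz ?frame_z_central //.
  case/ddk_inP: SG => Gr1 Gt1 Gr2 Gt2 _.
  rewrite andbC; congr (_ && _).
    apply: eq_forallb => j; apply: eq_forallb => k.
    rewrite !negbK !cmt_eq1 !cmt_pow // Sz zV.
    have powE (b c : bool) : (z ^+ b == (if c then z else 1)) = (b == c).
      by rewrite -pow_z_inj; case: c.
    by rewrite !powE.
  rewrite /surface_relations !big_ord_recl !big_ord0 !mulg1 Sz zV.
  rewrite -!/(cmt _ _) !cmt_pow ?groupV //.
  have -> : rev_ord (ord0 : 'I_2) = ord_max by apply: val_inj.
  have -> : rev_ord (lift ord0 ord0 : 'I_2) = ord0 by apply: val_inj.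
  have -> : lift ord0 ord0 = ord_max :> 'I_2 by apply: val_inj.
  have ncV x y : (x \in 'C[y^-1]) = (x \in 'C[y]) by rewrite !(cent1C x) groupV.
  have collapse x y (b c : bool) : x \in G ->
      (z ^+ b * x * (z ^+ c * y) * (y^-1 * x^-1) == z) = b (+) c.
    move=> Gx; have xz : x * z ^+ c = z ^+ c * x.
      by case/centerP: frame_z_central => _ cz; apply/commuteX/commute_sym/cz.
    rewrite !mulgA mulgK -(mulgA _ x) xz mulgA mulgK -(expg_addb _ _ (frame_zz F)).
    by rewrite -[X in _ == X]/(z ^+ true) pow_z_inj eqb_id.
  have collapseV x y (b c : bool) : x \in G ->
      (z ^+ b * x^-1 * (z ^+ c * y^-1) * (y * x) == z) = b (+) c.
    by move=> Gx; have := collapse x^-1 y^-1 b c; rewrite !invgK groupV; apply.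
  by rewrite !ncV collapse // collapseV // addbC.
apply/idP/idP.
  case/and4P=> _ _ /eqP genS /andP[/eqP oz Rs].
  have SG : ddk_in G S by rewrite -ddk_generated_sub genS.
  have nt_zS : ddk_z S != 1 by rewrite -order_gt1 oz.
  case/and3P: (Rs) => _ Rr Rt.
  have Sz : ddk_z S = z.
    have := @ddk_z_central _ G 2 S isT SG nt_zS Rr Rt oG.
    by rewrite frame_center !inE (negPf nt_zS) => /eqP.
  by rewrite SG Sz eqxx -relE.
case/and3P=> SG /eqP Sz; rewrite -relE // => Rs.
rewrite /is_ddk /= Sz o_z eqxx Rs /= andbT.
case/and3P: (Rs) => _ Rr Rt.
have nt_zS : ddk_z S != 1 by rewrite Sz.
have [K1G _] := @ddk_order32_strong _ G 2 S isT SG nt_zS Rr Rt oG.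
apply/eqP/val_inj/eqP; rewrite eqEsubset ddk_generated_sub SG -{1}K1G /=.
by rewrite genS // setUS // -(setUA (_ :|: _)) subsetUl.
Qed.

End FramedStructures.

(** * Counting pairs of dual bases *)

Definition all_vec : seq vec :=
  let bits := [:: false; true] in
  [seq (ijk, l) | ijk <- [seq (ij, k) | ij <- [seq (i, j) | i <- bits, j <- bits],
                                      k <- bits], l <- bits].

(** A sum over the vectors that satisfy p, in a form that evaluates without
    visiting F outside p; nesting such sums prunes the enumeration. *)
Definition guarded_sum (p : vec -> bool) (F : vec -> nat) : nat :=
  foldr (fun v n => if p v then (F v + n)%N else n) 0%N all_vec.

Lemma guarded_sumE p F : guarded_sum p F = (\sum_v (if p v then F v else 0))%N.
Proof.
have -> : (\sum_v (if p v then F v else 0) =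
           \sum_(v <- all_vec) (if p v then F v else 0))%N.
  have sum_bool (T : finType) (E : T * bool -> nat) :
      (\sum_x E x = \sum_i (E (i, false) + E (i, true)))%N.
    rewrite (eq_bigr (fun p => E (p.1, p.2))) => [|[] //].
    rewrite -(pair_bigA _ (fun i b => E (i, b))) /=.
    by apply: eq_bigr => i _; rewrite big_bool addnC.
  rewrite sum_bool sum_bool sum_bool big_bool /all_vec /= !big_cons big_nil.
  lia.
rewrite /guarded_sum; elim: all_vec => [|v s IH] /=; first by rewrite big_nil.
by rewrite big_cons -IH; case: (p v).
Qed.

Lemma sum_ffun2 (T : finType) (F : T -> T -> nat) :
  (\sum_(A : {ffun 'I_2 -> T}) F (A ord0) (A ord_max) = \sum_x \sum_y F x y)%N.
Proof.
rewrite pair_bigA /=.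
pose h (p : T * T) := [ffun i : 'I_2 => if i == ord0 then p.1 else p.2].
rewrite (reindex h) /=; first by apply: eq_bigr => p _; rewrite !ffunE.
exists (fun A : {ffun 'I_2 -> T} => (A ord0, A ord_max)) => [[x y] _ | A _].
  by rewrite !ffunE.
apply/ffunP=> i; rewrite ffunE; case: eqP => [-> // | ni].
by congr (A _); apply: val_inj; case: i ni => [[|[|[]]] lti] //= [] ; apply: val_inj.
Qed.

Lemma sum_fst_bool (D : vec -> nat) :
  (\sum_(m : vec * bool) D m.1 = 2 * \sum_v D v)%N.
Proof.
rewrite -(pair_bigA _ (fun v b => D v)) /= big_distrr /=.
by apply: eq_bigr => v _; rewrite sum_nat_const card_bool.
Qed.

(** Each vector has two lifts to vec * bool, so a sum over pairs of lifts of a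
    function of the vectors counts every pair of vectors 4 times. *)
Lemma sum_lifts k (E : {ffun 'I_2 -> vec * bool} -> nat) (F : vec -> vec -> nat) :
    (forall A, E A = k * F (A ord0).1 (A ord_max).1)%N ->
  (\sum_A E A = (4 * k) * \sum_v \sum_w F v w)%N.
Proof.
move=> EF; rewrite (eq_bigr _ (fun A _ => EF A)) -big_distrr /= (mulnC 4 k) -mulnA.
congr (k * _)%N.
rewrite (sum_ffun2 (fun m n : vec * bool => F m.1 n.1)).
rewrite (sum_fst_bool (fun v => \sum_(n : vec * bool) F v n.1)%N).
rewrite -[4%N]/(2 * 2)%N -mulnA; congr (2 * _)%N.
rewrite big_distrr; apply: eq_bigr => v _; exact: sum_fst_bool.
Qed.

Lemma sum_quadruples (T : finType) (E : T -> T -> T -> T -> nat) :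
  (\sum_(X : T * T * T * T) E X.1.1.1 X.1.1.2 X.1.2 X.2
     = \sum_A \sum_B \sum_C \sum_D E A B C D)%N.
Proof. by rewrite !pair_bigA. Qed.

(** The conditions of dual_bases on the vectors of r1, t2, r2, t1, in this
    order, grouped by the last vector that they mention; each group prunes the
    enumeration as soon as its vectors are chosen. *)
Definition dual_vectors (a a' d d' c c' b b' : vec) : bool :=
  let o v w := ~~ alt_form v w in
  [&& alt_form a d && o a' d, o a d' && alt_form a' d', o a c && o a' c,
      [&& o a c', o a' c' & alt_form c d (+) alt_form c' d'],
      [&& o b d, o b d', alt_form b c & o b c']
    & [&& o b' d, o b' d', o b' c, alt_form b' c'
        & alt_form a b (+) alt_form a' b']].

(** The vectors of r1 and t1 form one of the 20160 bases of the space of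
    vectors, which determines its dual basis. The group of isometries, of order
    720, acts freely on bases, with 28 orbits given by the Gram matrices; the
    surface condition holds for 12 of them, and it holds for a basis exactly
    when it holds for its dual. The enumeration below confirms 12 * 720. *)
Lemma count_dual_vectors :
  (\sum_a \sum_a' \sum_d \sum_d' \sum_c \sum_c' \sum_b \sum_b'
     dual_vectors a a' d d' c c' b b' = 120 * 72)%N.
Proof.
pose o v w := ~~ alt_form v w.
transitivity (guarded_sum xpredT (fun a => guarded_sum xpredT (fun a' =>
  guarded_sum (fun d => alt_form a d && o a' d) (fun d =>
  guarded_sum (fun d' => o a d' && alt_form a' d') (fun d' =>
  guarded_sum (fun c => o a c && o a' c) (fun c =>
  guarded_sum (fun c' => [&& o a c', o a' c' & alt_form c d (+) alt_form c' d']) (fun c' =>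
  guarded_sum (fun b => [&& o b d, o b d', alt_form b c & o b c']) (fun b =>
  guarded_sum (fun b' => [&& o b' d, o b' d', o b' c, alt_form b' c'
        & alt_form a b (+) alt_form a' b']) (fun=> 1%N))))))))); last by vm_compute.
rewrite /dual_vectors -!/(o _ _).
rewrite guarded_sumE; apply: eq_bigr => a _; rewrite guarded_sumE; apply: eq_bigr => a' _.
do 6!(rewrite guarded_sumE; apply: eq_bigr => ? _; case: ifP => /= _;
  last by do ?(rewrite big1 // => ? _)).
by [].
Qed.

Section CountStructures.

Variables (gT : finGroupType) (G : {group gT}).
Variables (q : vec) (z e1 f1 e2 f2 : gT).
Hypotheses (F : frame q z e1 f1 e2 f2) (nt_z : z != 1).
Hypotheses (oG : #|G| = 32%N).
Hypotheses (GF : [/\ e1 \in G, f1 \in G, e2 \in G & f2 \in G]).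

Local Notation word := (frame_word z e1 f1 e2 f2).
Local Notation lifts := {ffun 'I_2 -> vec * bool}.

Definition structure_of (X : lifts * lifts * lifts * lifts) : ddkTuple gT 2 :=
  ([ffun j => word (X.1.1.1 j)], [ffun j => word (X.2 j)],
   [ffun j => word (X.1.2 j)], [ffun j => word (X.1.1.2 j)], z).

Lemma structure_of_inj : injective structure_of.
Proof.
have liftE (A B : lifts) : [ffun j => word (A j)] = [ffun j => word (B j)] -> A = B.
  move=> eAB; apply/ffunP=> j; apply: (word_inj F nt_z).
  by move/ffunP/(_ j): eAB; rewrite !ffunE.
by move=> [[[A D] C] B] [[[A' D'] C'] B'] [] /liftE-> /liftE-> /liftE-> /liftE->.
Qed.

Lemma forall_ord2 (P : pred 'I_2) : [forall j, P j] = P ord0 && P ord_max.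
Proof.
apply/forallP/andP => [P2 | [P0 P1] j]; first by rewrite !P2.
have [->|] := eqVneq j ord0; first exact: P0.
by case: j => [[|[|]] lt2] // _; rewrite (_ : Ordinal lt2 = ord_max) //; apply: val_inj.
Qed.

Lemma dual_bases_structure_of (X : lifts * lifts * lifts * lifts) :
  dual_bases (structure_of X) =
    dual_vectors (X.1.1.1 ord0).1 (X.1.1.1 ord_max).1
                 (X.1.1.2 ord0).1 (X.1.1.2 ord_max).1
                 (X.1.2 ord0).1 (X.1.2 ord_max).1
                 (X.2 ord0).1 (X.2 ord_max).1.
Proof.
case: X => [[[A D] C] B] /=.
rewrite /dual_bases !forall_ord2 /= !ffunE !(word_comm F) // /dual_vectors.
rewrite !negbK !eqb_id !eqbF_neg -!andbA.
by do !bool_congr.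
Qed.

Lemma structure_ofP (S : ddkTuple gT 2) :
  ddk_in G S -> ddk_z S = z -> exists X, S = structure_of X.
Proof.
case/ddk_inP=> Gr1 Gt1 Gr2 Gt2 _ Sz.
have lift (f : {ffun 'I_2 -> gT}) : (forall j, f j \in G) ->
    exists A : lifts, f = [ffun j => word (A j)].
  move=> Gf; exists [ffun j => odflt (false, false, false, false, false) [pick m | word m == f j]].
  apply/ffunP=> j; rewrite !ffunE; case: pickP => [m /eqP-> // | none].
  have /(wordP F nt_z oG GF)[m fm] := Gf j.
  by have := none m; rewrite -fm eqxx.
have [[A eA] [B eB]] := (lift _ Gr1, lift _ Gt1).
have [[C eC] [D eD]] := (lift _ Gr2, lift _ Gt2).
exists (A, D, C, B); rewrite /structure_of /= -eA -eB -eC -eD -Sz.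
by case: (S) => [[[[]]]].
Qed.

Lemma structures_image : ddk_structures G 2 2 =
  structure_of @: [set X | dual_bases (structure_of X)].
Proof.
apply/setP=> S; rewrite inE (structures_frameE F nt_z oG GF).
apply/idP/imsetP => [/and3P[SG /eqP Sz dS] | [X]].
  by have [X eS] := structure_ofP SG Sz; exists X; rewrite ?inE -?eS.
rewrite inE => dX ->; apply/and3P; split=> //.
have GW := word_in F nt_z oG GF.
by apply/ddk_inP; split=> [j|j|j|j|]; rewrite ?ffunE // (frame_z_in F GF).
Qed.

Lemma card_structures : #|ddk_structures G 2 2| = (1152 * 1920)%N.
Proof.
rewrite structures_image card_imset; last exact: structure_of_inj.
rewrite -sum1dep_card big_mkcond /=.
transitivity (\sum_(X : lifts * lifts * lifts * lifts)
  dual_vectors (X.1.1.1 ord0).1 (X.1.1.1 ord_max).1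
               (X.1.1.2 ord0).1 (X.1.1.2 ord_max).1
               (X.1.2 ord0).1 (X.1.2 ord_max).1
               (X.2 ord0).1 (X.2 ord_max).1)%N.
  by apply: eq_bigr => X _; rewrite dual_bases_structure_of; case: dual_vectors.
rewrite (sum_quadruples (fun A D C B : lifts => nat_of_bool
  (dual_vectors (A ord0).1 (A ord_max).1 (D ord0).1 (D ord_max).1
                (C ord0).1 (C ord_max).1 (B ord0).1 (B ord_max).1))).
transitivity ((4 * (4 * (4 * (4 * 1)))) * (120 * 72))%N; last by lia.
rewrite -count_dual_vectors.
by do 4!(apply: sum_lifts => ?); rewrite mul1n.
Qed.

End CountStructures.

(** * Automorphisms of a framed group *)

(** The conditions under which words on these vectors form a frame with squares
    given by q, grouped by the last vector that they mention. *)
Definition frame_vectors (q e f e' f' : vec) : bool :=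
  let o v w := ~~ alt_form v w in
  [&& cocycle q e e == q.1.1.1,
      (cocycle q f f == q.1.1.2) && alt_form f e,
      [&& cocycle q e' e' == q.1.2, o e e' & o f e']
    & [&& cocycle q f' f' == q.2, alt_form f' e', o e f' & o f f']].

Lemma morph_frame (gT rT : finGroupType) (D : {group gT}) (f : {morphism D >-> rT})
    q (z e1 f1 e2 f2 : gT) :
    z \in D -> [/\ e1 \in D, f1 \in D, e2 \in D & f2 \in D] ->
  frame q z e1 f1 e2 f2 -> frame q (f z) (f e1) (f f1) (f e2) (f f2).
Proof.
move=> Dz [De1 Df1 De2 Df2].
have morph_commute x y : x \in D -> y \in D -> commute x y -> commute (f x) (f y).
  by move=> Dx Dy xy; rewrite /commute -!morphM // xy.
case=> zz ze1 zf1 ze2 zf2 ee1 ff1 ee2 ff2 fe1 fe2 e1e2 e1f2 f1e2 f1f2.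
split; try exact: morph_commute; rewrite -?morphX -?morphM ?groupM // ?zz ?ee1
  ?ff1 ?ee2 ?ff2 ?fe1 ?fe2 ?morph1 //.
Qed.

Section Aut.

Variables (gT : finGroupType) (G : {group gT}).
Variables (q : vec) (z e1 f1 e2 f2 : gT).
Hypotheses (F : frame q z e1 f1 e2 f2) (nt_z : z != 1).
Hypotheses (oG : #|G| = 32%N).
Hypotheses (GF : [/\ e1 \in G, f1 \in G, e2 \in G & f2 \in G]).

Local Notation word := (frame_word z e1 f1 e2 f2).
Let Gz : z \in G := frame_z_in F GF.
Let GW := word_in F nt_z oG GF.

Lemma frame_wordsP k l m n :
  reflect (frame q z (word k) (word l) (word m) (word n))
          (frame_vectors q k.1 l.1 m.1 n.1).
Proof.
have comP x y : ~~ alt_form x.1 y.1 <-> commute (word x) (word y).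
  by rewrite -(word_comm F x y nt_z); split=> /cent1P.
have antiP x y : alt_form x.1 y.1 <-> word x * word y = word y * word x * z.
  have eqz : word x * word y = word y * word x * z ^+ (alt_form x.1 y.1).
    have := cmt_pow F nt_z oG GF (GW x) (GW y).
    rewrite (word_comm F) // negbK => cz.
    have zc g : g \in G -> z ^+ (alt_form x.1 y.1) * g = g * z ^+ (alt_form x.1 y.1).
      have /centerP[_ cz1] := frame_z_central F nt_z oG GF => Gg.
      exact/commute_sym/commuteX/commute_sym/cz1.
    have GM := groupM (GW y) (GW x).
    rewrite -(zc _ GM) -cz /cmt; move: (word x) (word y) => g h.
    by rewrite !mulgA !mulgKV.
  rewrite {}eqz; case: alt_form => //; split=> // /mulgI/esym/eqP.
  by rewrite (negPf nt_z).
have sqP x (b : bool) : (cocycle q x.1 x.1 == b) <-> word x * word x = z ^+ b.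
  rewrite (word_sq F) -(pow_z_inj nt_z); split=> /eqP //.
have zcom x : commute z (word x).
  by have /centerP[_] := frame_z_central F nt_z oG GF; apply.
apply: (iffP and4P) => [[/sqP ek /andP[/sqP el /antiP lk] /and3P[/sqP em /comP km /comP lm]] | [] *].
  case/and4P=> /sqP en /antiP nm /comP kn /comP ln; split=> //.
  by case: F.
split; first exact/sqP.
- by apply/andP; split; [apply/sqP | apply/antiP].
- by apply/and3P; split; [apply/sqP | apply/comP | apply/comP].
- by apply/and4P; split; [apply/sqP | apply/antiP | apply/comP | apply/comP].
Qed.

Lemma Aut_frame_z a : a \in Aut G -> a z = z.
Proof.
move=> Aa; have: autm Aa z \in 'Z(G).
  have -> : 'Z(G) = 'Z(autm Aa @* G) by rewrite im_autm.
  rewrite -(injm_center (injm_autm Aa)) // mem_morphim //.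
  exact: (frame_z_central F nt_z oG GF).
rewrite (frame_center F nt_z oG GF) !inE autmE => /orP[|/eqP //].
by rewrite -(autmE Aa) (morph_injm_eq1 (injm_autm Aa)) // (negPf nt_z).
Qed.

Lemma Aut_frame a : a \in Aut G -> frame q z (a e1) (a f1) (a e2) (a f2).
Proof.
move=> Aa; have := morph_frame (autm Aa) Gz GF F.
by rewrite /= !autmE (Aut_frame_z Aa).
Qed.

(** Words multiply by the same rule in all frames with the same q, so the map
    between the normal forms in two frames is an automorphism. *)
Lemma frame_Aut x1 y1 x2 y2 :
    [/\ x1 \in G, y1 \in G, x2 \in G & y2 \in G] -> frame q z x1 y1 x2 y2 ->
  exists2 a, a \in Aut G & [/\ a e1 = x1, a f1 = y1, a e2 = x2 & a f2 = y2].
Proof.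
move=> GF' F'.
pose code g := odflt (false, false, false, false, false) [pick m | word m == g].
have wordK : cancel word code.
  move=> m; rewrite /code; case: pickP => [n /eqP /(word_inj F nt_z) // | /(_ m)].
  by rewrite eqxx.
pose f g := frame_word z x1 y1 x2 y2 (code g).
have fM : {in G &, {morph f : x y / x * y}}.
  move=> _ _ /(wordP F nt_z oG GF)[m ->] /(wordP F nt_z oG GF)[n ->].
  by rewrite /f (wordM F) !wordK (wordM F').
pose fm := Morphism fM.
have injf : 'injm fm.
  apply/injmP=> _ _ /(wordP F nt_z oG GF)[m ->] /(wordP F nt_z oG GF)[n ->] /=.
  by rewrite /f !wordK => /(word_inj F' nt_z)->.
have imf : fm @* G = G.
  apply/eqP; rewrite eqEcard card_injm // leqnn andbT.
  by apply/subsetP=> _ /morphimP[x _ _ ->]; apply: (word_in F' nt_z oG GF').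
exists (aut injf imf); first exact: Aut_aut.
have autW m : aut injf imf (word m) = frame_word z x1 y1 x2 y2 m.
  by rewrite autE ?GW //= /f wordK.
split.
- by have := autW (true, false, false, false, false); rewrite /frame_word /= ?mulg1 ?mul1g.
- by have := autW (false, true, false, false, false); rewrite /frame_word /= ?mulg1 ?mul1g.
- by have := autW (false, false, true, false, false); rewrite /frame_word /= ?mulg1 ?mul1g.
- by have := autW (false, false, false, true, false); rewrite /frame_word /= ?mulg1 ?mul1g.
Qed.

Lemma Aut_eq_on_frame a b : a \in Aut G -> b \in Aut G ->
    [/\ a e1 = b e1, a f1 = b f1, a e2 = b e2 & a f2 = b f2] -> a = b.
Proof.
move=> Aa Ab [ee1 ef1 ee2 ef2]; apply: (eq_Aut Aa Ab) => _ /(wordP F nt_z oG GF)[m ->].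
case: GF => Ge1 Gf1 Ge2 Gf2.
have autW c (Ac : c \in Aut G) : c (word m) = frame_word z (c e1) (c f1) (c e2) (c f2) m.
  rewrite -{2}(Aut_frame_z Ac) -!(autmE Ac) /frame_word.
  by rewrite !morphM ?morphX //; do ?[apply: groupM | apply: groupX].
by rewrite !autW // ee1 ef1 ee2 ef2.
Qed.

Local Notation quad T := (T * T * T * T)%type.

(** Automorphisms correspond to the frames with squares given by q, and each
    frame of vectors has 2 ^ 4 lifts. *)
Lemma card_Aut_frame : #|Aut G| = (16 * \sum_e \sum_f \sum_e' \sum_f'
   frame_vectors q e f e' f')%N.
Proof.
pose images (a : {perm gT}) : quad gT := (a e1, a f1, a e2, a f2).
pose words4 (X : quad (vec * bool)) : quad gT :=
  (word X.1.1.1, word X.1.1.2, word X.1.2, word X.2).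
have injA : {in Aut G &, injective images}.
  by move=> a b Aa Ab [*]; apply: Aut_eq_on_frame.
have injW : injective words4.
  by move=> [[[k l] m] n] [[[k' l'] m'] n'] [] /= /(word_inj F nt_z)-> /(word_inj F nt_z)->
    /(word_inj F nt_z)-> /(word_inj F nt_z)->.
rewrite -(card_in_imset injA).
have -> : images @: Aut G = words4 @:
    [set X | frame_vectors q X.1.1.1.1 X.1.1.2.1 X.1.2.1 X.2.1].
  apply/setP=> X; apply/imsetP/imsetP => [[a Aa ->] | [Y]].
    case: GF => Ge1 Gf1 Ge2 Gf2.
    have wa x : x \in G -> exists m, a x = word m.
      by move=> Gx; apply/(wordP F nt_z oG GF); rewrite Aut_closed.
    have [[k ek] [l el]] := (wa _ Ge1, wa _ Gf1).
    have [[m em] [n en]] := (wa _ Ge2, wa _ Gf2).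
    exists (k, l, m, n); last by rewrite /images ek el em en.
    by rewrite inE; apply/frame_wordsP; rewrite -ek -el -em -en; apply: Aut_frame.
  rewrite inE => /frame_wordsP FY ->.
  have [a Aa [eqs1 eqs2 eqs3 eqs4]] := frame_Aut (And4 (GW _) (GW _) (GW _) (GW _)) FY.
  by exists a; rewrite // /images eqs1 eqs2 eqs3 eqs4.
rewrite card_imset // -sum1dep_card big_mkcond /=.
transitivity (\sum_(X : quad (vec * bool)) frame_vectors q X.1.1.1.1 X.1.1.2.1 X.1.2.1 X.2.1)%N.
  by apply: eq_bigr => X _; case: frame_vectors.
rewrite (sum_quadruples (fun k l m n : vec * bool =>
   nat_of_bool (frame_vectors q k.1 l.1 m.1 n.1))).
have sum_lift k (E : vec * bool -> nat) (D : vec -> nat) :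
    (forall m, E m = k * D m.1)%N -> (\sum_m E m = (2 * k) * \sum_v D v)%N.
  move=> ED; rewrite (eq_bigr _ (fun A _ => ED A)) -big_distrr /= (mulnC 2 k) -mulnA.
  by rewrite sum_fst_bool.
rewrite -[16%N]/(2 * (2 * (2 * (2 * 1))))%N.
by do 4!(apply: (sum_lift) => ?); rewrite mul1n.
Qed.

End Aut.

Lemma tally_frame_vectors q :
  (\sum_e \sum_f \sum_e' \sum_f' frame_vectors q e f e' f')%N =
  guarded_sum (fun e => cocycle q e e == q.1.1.1) (fun e =>
  guarded_sum (fun f => (cocycle q f f == q.1.1.2) && alt_form f e) (fun f =>
  guarded_sum (fun e' => [&& cocycle q e' e' == q.1.2, ~~ alt_form e e' & ~~ alt_form f e']) (fun e' =>
  guarded_sum (fun f' => [&& cocycle q f' f' == q.2, alt_form f' e', ~~ alt_form e f'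
                     & ~~ alt_form f f']) (fun=> 1%N)))).
Proof.
rewrite /frame_vectors.
do 4!(rewrite guarded_sumE; apply: eq_bigr => ? _; case: ifP => /= _;
  last by do ?(rewrite big1 // => ? _)).
by [].
Qed.

(** * Orbits of automorphisms on structures *)

Section Orbits.

Variables (gT : finGroupType) (G : {group gT}).
Variables (q : vec) (z e1 f1 e2 f2 : gT).
Hypotheses (F : frame q z e1 f1 e2 f2) (nt_z : z != 1).
Hypotheses (oG : #|G| = 32%N).
Hypotheses (GF : [/\ e1 \in G, f1 \in G, e2 \in G & f2 \in G]).

Let structuresE S : (S \in ddk_structures G 2 2) =
  [&& ddk_in G S, ddk_z S == z & dual_bases S].
Proof. by rewrite inE (structures_frameE F nt_z oG GF). Qed.

Lemma Aut_acts_structures :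
  [acts Aut G, on ddk_structures G 2 2 | ddk_action gT 2].
Proof.
apply/subsetP=> a Aa; rewrite !inE; apply/subsetP=> S; rewrite structuresE inE structuresE.
case/and3P=> SG /eqP Sz dS; have /ddk_inP[Gr1 Gt1 Gr2 Gt2 _] := SG.
have aC x y : x \in G -> y \in G -> (a x \in 'C[a y]) = (x \in 'C[y]).
  move=> Gx Gy; rewrite -!cmt_eq1 /cmt -!(autmE Aa) -!morphV // -!morphM ?groupM ?groupV //.
  by rewrite (morph_injm_eq1 (injm_autm Aa)) // !groupM ?groupV.
have az := Aut_frame_z F nt_z oG GF Aa.
have Saz : ddk_z (ddk_act S a) = z by rewrite -[RHS]az -[in RHS]Sz.
apply/and3P; split; last first.
- move: dS; rewrite /dual_bases !forall_ord2 /ddk_act /=.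
  by rewrite !ffunE !aC.
- exact/eqP.
- apply/ddk_inP; split=> [j|j|j|j|]; last by rewrite Saz (frame_z_in F GF).
  all: by rewrite ffunE Aut_closed.
Qed.

Lemma Aut_free_structures S :
  S \in ddk_structures G 2 2 -> 'C_(Aut G)[S | ddk_action gT 2] = 1.
Proof.
rewrite inE => /and4P[_ _ /eqP genS _].
apply/trivgP/subsetP=> a /setIP[Aa /astab1P aS]; rewrite inE; apply/eqP.
have fixG : group_set [set x in G | a x == x].
  apply/group_setP; split=> [|x y].
    by rewrite inE group1 -(autmE Aa) morph1 eqxx.
  rewrite !inE => /andP[Gx /eqP ax] /andP[Gy /eqP ay].
  by rewrite groupM // -(autmE Aa) morphM //= !autmE ax ay eqxx.
have sGfix : G \subset Group fixG.
  have SG : ddk_in G S by rewrite -ddk_generated_sub genS.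
  have {SG}/ddk_inP[Gr1 Gt1 Gr2 Gt2 Gz] := SG.
  suff: ddk_generated S \subset Group fixG by rewrite {1}genS.
  rewrite ddk_generated_sub; case: S {genS} aS Gr1 Gt1 Gr2 Gt2 Gz => [[[[r1 t1] r2] t2] zS] /=.
  rewrite /ddk_act /= => -[/ffunP er1 /ffunP et1 /ffunP er2 /ffunP et2 ez] *.
  have fixf (f : {ffun 'I_2 -> gT}) j : [ffun j => a (f j)] j = f j -> a (f j) = f j.
    by rewrite ffunE.
  apply/ddk_inP; split=> [j|j|j|j|]; rewrite inE; apply/andP; split=> //; apply/eqP => //;
    exact: fixf.
apply: (eq_Aut Aa (group1 _)) => x Gx; rewrite perm1.
by have := subsetP sGfix x Gx; rewrite inE => /andP[_ /eqP].
Qed.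

Lemma card_orbits : (#|ddk_orbits G 2 2| * #|Aut G| = 1152 * 1920)%N.
Proof.
rewrite -(card_structures F nt_z oG GF).
apply/esym/(card_uniform_partition _ (orbit_partition Aut_acts_structures)).
move=> _ /imsetP[S SG ->].
by rewrite card_orbit Aut_free_structures // indexg1.
Qed.

End Orbits.

Lemma count_frame_vectors (d : bool) :
  (\sum_e \sum_f \sum_e' \sum_f' frame_vectors (false, false, d, d) e f e' f'
     = if d then 120 else 72)%N.
Proof. by rewrite tally_frame_vectors; case: d; vm_compute. Qed.

(** * The two presented groups *)

(** Permutations of vec that translate the first three bits and add a function
    of these bits to the last one. They provide a group in which the presented
    relations hold with z nontrivial. *)
Definition shear_fun (x a b : bool) (phi : bool -> bool -> bool -> bool) (v : vec) : vec :=
  (v.1.1.1 (+) x, v.1.1.2 (+) a, v.1.2 (+) b, v.2 (+) phi v.1.1.1 v.1.1.2 v.1.2).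

Lemma shear_inj x a b phi : injective (shear_fun x a b phi).
Proof.
move=> [[[x1 a1] b1] s1] [[[x2 a2] b2] s2] [].
by move=> /addIb-> /addIb-> /addIb-> /addIb->.
Qed.

Definition shear x a b phi : {perm vec} := perm (@shear_inj x a b phi).

(** The first bit carries a dihedral group of order 8, and the next two carry a
    dihedral or, for d = true, a quaternion group, with the same center. *)
Lemma shear_frame (d : bool) :
  frame (false, false, d, d) (shear false false false (fun _ _ _ => true))
    (shear true false false (fun _ _ _ => false))
    (shear false false false (fun x _ _ => x))
    (shear false true false (fun _ a _ => d && a))
    (shear false false true (fun _ a b => a (+) d && b)).
Proof.
case: d; split; apply/permP=> -[[[x a] b] s]; rewrite /= ?(permM, perm1, permE);
  by case: x a b s => [] [] [] [].
Qed.

Lemma shear_z_neq1 : shear false false false (fun _ _ _ => true) != 1.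
Proof.
by apply/eqP=> /permP/(_ (false, false, false, false)); rewrite !permE.
Qed.

Lemma frame_cmt (gT : finGroupType) d (z r1 t1 r2 t2 : gT) :
  frame (false, false, d, d) z r1 t1 r2 t2 <->
  [/\ [/\ r1 ^+ 2 = 1, t1 ^+ 2 = 1, r2 ^+ 2 = z ^+ d, t2 ^+ 2 = z ^+ d & z ^+ 2 = 1],
      [/\ r1 * z * r1^-1 * z^-1 = 1, t1 * z * t1^-1 * z^-1 = 1,
          r2 * z * r2^-1 * z^-1 = 1 & t2 * z * t2^-1 * z^-1 = 1],
      r1 * r2 * r1^-1 * r2^-1 = 1 /\ t1 * t2 * t1^-1 * t2^-1 = 1,
      r1 * t1 * r1^-1 * t1^-1 = z^-1 /\ r2 * t2 * r2^-1 * t2^-1 = z^-1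
    & r1 * t2 * r1^-1 * t2^-1 = 1 /\ r2 * t1 * r2^-1 * t1^-1 = 1].
Proof.
have comP (x y : gT) : commute y x <-> x * y * x^-1 * y^-1 = 1.
  by split=> [/commute_sym xy | /eqP/cmtP/commute_sym //]; apply/eqP/cmtP.
have antiP (x y : gT) : commute z x -> commute z y ->
    (y * x = x * y * z <-> x * y * x^-1 * y^-1 = z^-1).
  move=> zx zy; have zxy : z * (x * y) = x * y * z by apply: commuteM.
  split=> [yx | xy]; last first.
    by rewrite -zxy -[x * y](mulgK x^-1) -[x * y * _](mulgK y^-1) !invgK xy !mulgA mulgV mul1g.
  apply/(mulIg y)/(mulIg x); rewrite !mulgKV -mulgA yx -zxy mulKg //.
rewrite !expg2; split.
  case=> zz ze1 zf1 ze2 zf2 ee1 ff1 ee2 ff2 fe1 fe2 e1e2 e1f2 f1e2 f1f2.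
  by split; split=> //; first [exact/comP | exact/comP/commute_sym | exact/antiP].
case=> [[rr1 tt1 rr2 tt2 zz] [/comP zr1 /comP zt1 /comP zr2 /comP zt2]].
case=> /comP r12 /comP t12 [rt1 rt2] [/comP r1t2 /comP r2t1].
split=> //; try (by apply/antiP); by apply/commute_sym.
Qed.

Lemma shear_model (d : bool) : exists (rT : finGroupType) (z r1 t1 r2 t2 : rT),
  frame (false, false, d, d) z r1 t1 r2 t2 /\ z != 1.
Proof.
by do 6!eexists; split; [apply: shear_frame | apply: shear_z_neq1].
Qed.

(** With z = 1 a word only depends on its 4 bits. *)
Lemma words_z_neq1 (gT : finGroupType) (z e1 f1 e2 f2 : gT) :
  (32 <= #|words z e1 f1 e2 f2|)%N -> z != 1.
Proof.
apply: contraTneq => ->; rewrite -ltnNge.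
apply: (@leq_ltn_trans #|[set frame_word 1 e1 f1 e2 f2 (v, false) | v : vec]|).
  apply/subset_leq_card/subsetP=> _ /imsetP[[v s] _ ->]; apply/imsetP; exists v => //.
  by rewrite /frame_word expg1n.
by apply: leq_ltn_trans (leq_imset_card _ _) _; rewrite !card_prod card_bool.
Qed.

Section Presented.

Variables (gT : finGroupType) (G : {group gT}) (d : bool) (z r1 t1 r2 t2 : gT).
Hypothesis F : frame (false, false, d, d) z r1 t1 r2 t2.
Hypothesis defG : <[r1]> <*> <[t1]> <*> <[r2]> <*> <[t2]> <*> <[z]> = G.

Lemma presented_in : [/\ r1 \in G, t1 \in G, r2 \in G & t2 \in G] /\ z \in G.
Proof.
have: G \subset G := subxx G; rewrite -{1}defG !join_subG !cycle_subG -!andbA.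
by case/and5P.
Qed.

Lemma presented_words : words z r1 t1 r2 t2 = G.
Proof.
apply/eqP; rewrite eqEsubset; apply/andP; split.
  apply/subsetP=> _ /imsetP[m _ ->].
  by have [GF Gz] := presented_in; apply: word_z_in.
have [wr1 wt1 wr2 wt2 wz] := words_gen z r1 t1 r2 t2.
by rewrite -defG -[words _ _ _ _ _]/(gval (Group (words_group_set F)))
   !join_subG !cycle_subG -!andbA; apply/and5P.
Qed.

Lemma presented_card_ge32 : z != 1 -> (32 <= #|G|)%N.
Proof. by move=> nt_z; rewrite -presented_words (card_words F nt_z). Qed.

Lemma presented_orbits : (32 <= #|G|)%N ->
  (#|ddk_orbits G 2 2| * (16 * if d then 120 else 72) = 1152 * 1920)%N.
Proof.
move=> geG; have [GF Gz] := presented_in.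
have nt_z : z != 1.
  by apply: (@words_z_neq1 _ z r1 t1 r2 t2); rewrite presented_words.
have oG : #|G| = 32%N by rewrite -presented_words (card_words F nt_z).
by rewrite -(card_orbits F nt_z oG GF) (card_Aut_frame F nt_z oG GF) count_frame_vectors.
Qed.

End Presented.

(** The presented group has order at most 32 because its elements are words in
    the generators, and at least 32 because it maps onto the group that the
    permutations of shear_model generate. *)
Lemma H5_orbits (gT : finGroupType) (G : {group gT}) :
  is_H5Z2 G -> #|ddk_orbits G 2 2| = 1920%N.
Proof.
move=> isoG; have := isoGrp_hom isoG.
case/existsP=> -[[[[r1 t1] r2] t2] z] /eqP[defG rr1 tt1 rr2 tt2 zz].
move=> zr1 zt1 zr2 zt2 r12 t12 rt1 rt2 r1t2 r2t1.
have F : frame (false, false, false, false) z r1 t1 r2 t2 by apply/frame_cmt.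
suff geG : (32 <= #|G|)%N by have := presented_orbits F defG geG; lia.
have [rT [y [s1 [u1 [s2 [u2 [Fy nt_y]]]]]]] := shear_model false.
have geM := @presented_card_ge32 _
  (<[s1]> <*> <[u1]> <*> <[s2]> <*> <[u2]> <*> <[y]>)%G _ _ _ _ _ _ Fy erefl nt_y.
apply: leq_trans geM _; apply: leq_homg; rewrite isoG; apply/existsP.
exists (s1, u1, s2, u2, y); apply/eqP.
have [[m1 m2 m3 m4 m5] [m6 m7 m8 m9] [m10 m11] [m12 m13] [m14 m15]] := (frame_cmt _ _ _ _ _ _).1 Fy.
by rewrite /= m1 m2 m3 m4 m5 m6 m7 m8 m9 m10 m11 m12 m13 m14 m15.
Qed.

Lemma G5_orbits (gT : finGroupType) (G : {group gT}) :
  is_G5Z2 G -> #|ddk_orbits G 2 2| = 1152%N.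
Proof.
move=> isoG; have := isoGrp_hom isoG.
case/existsP=> -[[[[r1 t1] r2] t2] z] /eqP[defG rr1 tt1 zz rr2 tt2].
move=> zr1 zt1 zr2 zt2 r12 t12 rt1 rt2 r1t2 r2t1.
have F : frame (false, false, true, true) z r1 t1 r2 t2 by apply/frame_cmt.
suff geG : (32 <= #|G|)%N by have := presented_orbits F defG geG; lia.
have [rT [y [s1 [u1 [s2 [u2 [Fy nt_y]]]]]]] := shear_model true.
have geM := @presented_card_ge32 _
  (<[s1]> <*> <[u1]> <*> <[s2]> <*> <[u2]> <*> <[y]>)%G _ _ _ _ _ _ Fy erefl nt_y.
apply: leq_trans geM _; apply: leq_homg; rewrite isoG; apply/existsP.
exists (s1, u1, s2, u2, y); apply/eqP.
have [[m1 m2 m3 m4 m5] [m6 m7 m8 m9] [m10 m11] [m12 m13] [m14 m15]] := (frame_cmt _ _ _ _ _ _).1 Fy.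
by rewrite /= m1 m2 m3 m4 m5 m6 m7 m8 m9 m10 m11 m12 m13 m14 m15.
Qed.

Unset Implicit Arguments.

Theorem mainTheorem1 (gT : finGroupType) (G : {group gT}) :
  (admits_ddk G -> (32 <= #|G|)%N)
  /\ (#|G| = 32%N -> (admits_ddk G <-> extraspecial G))
  /\ (#|G| = 32%N -> extraspecial G ->
        #|ddk_structures G 2 2| = (1152 * 1920)%N
        /\ forall S : ddkTuple gT 2, S \in ddk_structures G 2 2 ->
             ddk_strong G S /\ ddk_signature G S = 16%:R%R)
  /\ (is_H5Z2 G -> #|ddk_orbits G 2 2| = 1920%N)
  /\ (is_G5Z2 G -> #|ddk_orbits G 2 2| = 1152%N).
Proof.
have unpack b n (S : ddkTuple gT b) : is_ddk G n S ->
    [/\ (2 <= b)%N, ddk_in G S, ddk_z S != 1, r1_action_relations S & t1_action_relations S].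
  case/and5P=> b2 n2 /eqP genS /eqP oz /and3P[_ Rr Rt]; split=> //.
    by rewrite -ddk_generated_sub genS.
  by rewrite -order_gt1 oz.
have count32 : #|G| = 32%N -> extraspecial G -> #|ddk_structures G 2 2| = (1152 * 1920)%N.
  move=> oG esG; have [q [z [e1 [f1 [e2 [f2 [F nt_z _ GF]]]]]]] := extraspecial_frame oG esG.
  exact: card_structures F nt_z oG GF.
split=> [[b [n [S /unpack[b2 SG nt_z Rr Rt]]]] |].
  exact: ddk_card_ge32 b2 SG nt_z Rr Rt.
split=> [oG |].
  split=> [[b [n [S /unpack[b2 SG nt_z Rr Rt]]]] | esG].
    exact: ddk_order32_extraspecial b2 SG nt_z Rr Rt oG.
  have: (0 < #|ddk_structures G 2 2|)%N by rewrite count32.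
  by case/card_gt0P=> S; rewrite inE; exists 2%N, 2%N, S.
split=> [oG esG | ].
  split=> [|S]; first exact: count32.
  rewrite inE => ddkS; have [b2 SG nt_z Rr Rt] := unpack _ _ _ ddkS.
  split; first exact: ddk_order32_strong b2 SG nt_z Rr Rt oG.
  by case/and5P: ddkS => _ _ _ /eqP oz _; rewrite /ddk_signature oz oG; apply/eqP; vm_compute.
by split; [apply: H5_orbits | apply: G5_orbits].
Qed.
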